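(* Let $l:[1,\infty)\to(0,\infty)$ be a generalized proximate order such that $0<\liminf_{t\to\infty}l(t)=l_1<\limsup_{t\to\infty}l(t)=l_2<\infty$. Let $\varepsilon>0$, $0<q<1$ and $1\le R<\infty$. Let $G$ be analytic and non-vanishing and such that $$\log|G(re^{i\theta})|<r^{\frac{l(r)}{1+\varepsilon}}$$ on the domain $\left\{re^{i\theta}:R<r<\infty,\ |\theta|\le\frac{\pi}{2l(r)q}\right\}$. Then, for each $0<\delta<\frac{\pi}{2l_2q}$, we have $$\log|G(re^{i\theta})|>-r^{l(r)},\qquad |\theta|\le\frac{\pi}{2l(r)q}-\delta,\quad r\to\infty,$$ that is, there exists $r_1$ such that the inequality holds for all $r\ge r_1$ and all such $\theta$.
   Context: A function $l:[r_0,\infty)\to(0,\infty)$, $1\le r_0<\infty$, is called a generalized proximate order if $l\in C^1[r_0,\infty)$, $\limsup_{t\to\infty}l(t)$ and $\liminf_{t\to\infty}l(t)$ are finite, and $\limsup_{t\to\infty}|l'(t)|\,t\log t=0$. *)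

(* Defs.v *)
From Stdlib Require Import Reals.
From Coquelicot Require Import Coquelicot.

Local Open Scope R_scope.

(* Upper and lower limits at +oo, as extended reals: inf_M sup_(t >= M) f(t)
   and sup_M inf_(t >= M) f(t).  Only the values of f near +oo matter, so they
   apply to any total extension of a function given on a half-line. *)
Definition LimSup_infty (f : R -> R) : Rbar :=
  Rbar_glb (fun y : Rbar => exists M : R,
    y = Lub_Rbar (fun v : R => exists t : R, M <= t /\ v = f t)).

Definition LimInf_infty (f : R -> R) : Rbar :=
  Rbar_lub (fun y : Rbar => exists M : R,
    y = Glb_Rbar (fun v : R => exists t : R, M <= t /\ v = f t)).

(* [f] is C^1 on [r0, +oo) with derivative [df].  The difference quotients only
   use points of [r0, +oo), so the derivative at r0 is the right derivative. *)
Definition C1_from (r0 : R) (f df : R -> R) : Prop :=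
  (forall t : R, r0 <= t ->
     filterlim (fun s : R => (f s - f t) / (s - t))
       (within (fun s : R => r0 <= s) (locally' t)) (locally (df t))) /\
  continuous_on (fun t : R => r0 <= t) df.

(* A function on [r0, +oo) is encoded as a total function, of which only the
   values on [r0, +oo) are constrained. *)
Definition generalized_proximate_order (r0 : R) (l : R -> R) : Prop :=
  1 <= r0 /\
  (forall t : R, r0 <= t -> 0 < l t) /\
  is_finite (LimSup_infty l) /\
  is_finite (LimInf_infty l) /\
  exists dl : R -> R,
    C1_from r0 l dl /\
    LimSup_infty (fun t : R => Rabs (dl t) * t * ln t) = Finite 0.

Definition polar (r theta : R) : C := (r * cos theta, r * sin theta).

(* A subset of the plane, not of the Riemann surface of the logarithm: when
   l r * q < 1 / 2 the angles wrap around. *)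
Definition curved_sector (l : R -> R) (q rho : R) (z : C) : Prop :=
  exists r theta : R,
    rho < r /\ Rabs theta <= PI / (2 * l r * q) /\ z = polar r theta.

(* Analyticity at every point of D, in the sense of a convergent power series
   representation in a full neighbourhood of the point. *)
Definition analytic_on (D : C -> Prop) (G : C -> C) : Prop :=
  forall z : C, D z ->
    exists (a : nat -> C) (eps : R), 0 < eps /\
      forall w : C, Cmod (Cminus w z) < eps ->
        is_pseries (K := C_AbsRing) (V := C_NormedModule)
          a (Cminus w z) (G w).

(* Main.v *)
Require Import Defs.
From Stdlib Require Import Reals Lra Lia Classical.
From Coquelicot Require Import Coquelicot.

(** Why the theorem holds.  Put z = exp (s + i t), h (s, t) = ln |G z| and
    L s = l (exp s).  In these coordinates the curved sector is a strip
    |t| <= PI / (2 L(s) q) whose width hardly changes on windows of bounded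
    length, because L'(s) = o(1/s).  There h is harmonic and h <= exp (p s L(s))
    with p = 1 / (1 + eps) < 1, and the claim is -h < exp (s L(s)) at distance
    delta from the edges.

    A positive harmonic function in a strip of width PI / a grows at most like
    exp (a s) along it.  With a close to L q this is slower than exp (s L(s)),
    whose logarithmic derivative is L + o(1).  On a window where h <= M the
    positive harmonic function is M - h, and M is itself of a lower order than
    exp (s L(s)).  So [axis_lower_bound] propagates a bound
    -h (s, 0) <= C exp (q3 s L(s)), with max p q < q3 < 1, from window to window:
    each window costs a fixed constant factor, which the gap between q and q3
    absorbs once the windows are long.  Finally Harnack's inequality on a
    vertical segment carries the bound from the axis to the rest of the strip,
    at the price of a constant, and q3 < 1 absorbs it ([sector_lower_bound]).

    Two tools for a positive harmonic function u carry the argument.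
    - [window_growth]: the moment F(s) of u(s, .) against cos (a t) over
      |t| <= PI / (2 a) satisfies F'' <= a^2 F, because the cosine is a Dirichlet
      eigenfunction of the cross-section; a Wronskian comparison with sinh turns
      this into growth at most exp (a T) over a length T.
    - [harnack_vertical]: integrating u against 1 + sin and 1 - sin over a circle
      of radius r bounds |u_t| by 2 u / r at the centre; integrating that along a
      segment compares values of u, and so compares F with u on the axis.

    Both use h only through a holomorphic function phi = h_s - i h_t = z G'(z)/G(z)
    with a continuous derivative.  It comes from differentiating the power series
    of G three times ([pseries_C_derive], [log_modulus_harmonic]); no branch of
    log G is chosen, so it does not matter that the plane sector may overlap
    itself. *)

Local Open Scope R_scope.

Local Notation is_C_derive f z d := (@is_derive C_AbsRing C_NormedModule f z d).

(** * Complex derivatives of power series *)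

Lemma is_C_derive_eps (f : C -> C) (z d : C) :
  is_C_derive f z d <->
  (forall eps : R, 0 < eps -> exists delta : R, 0 < delta /\ forall w : C,
     Cmod (w - z) < delta ->
     Cmod (f w - f z - d * (w - z)) <= eps * Cmod (w - z)).
Proof.
split.
- intros [_ H] eps He.
  destruct (H z (fun P HP => HP) (mkposreal eps He)) as [delta Hd].
  exists delta; split; [apply cond_pos|].
  intros w Hw. generalize (Hd w Hw).
  unfold norm, minus, plus, opp, scal; simpl. unfold mult; simpl.
  intros Hn. unfold Cminus. rewrite (Cmult_comm d). exact Hn.
- intros H; split.
  + apply is_linear_scal_l.
  + intros x Hx.
    apply (@is_filter_lim_locally_unique C_AbsRing (AbsRing_NormedModule C_AbsRing)) in Hx.
    subst x.
    intros eps. destruct (H eps (cond_pos eps)) as [delta [Hd Hw]].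
    exists (mkposreal delta Hd). intros w Hball.
    generalize (Hw w Hball).
    unfold norm, minus, plus, opp, scal; simpl. unfold mult; simpl.
    unfold Cminus. rewrite (Cmult_comm d). intros Hn; exact Hn.
Qed.

(** Makes n^2 / 4^n summable by comparison with a geometric series. *)
Lemma sqr_le_pow2 (n : nat) : INR n ^ 2 <= 3 * 2 ^ n.
Proof.
assert (H : INR n ^ 2 + 2 * INR n + 3 <= 3 * 2 ^ n).
{ induction n as [|n IH]; [simpl; lra|].
  rewrite S_INR. change (2 ^ S n) with (2 * 2 ^ n). nra. }
generalize (pos_INR n); nra.
Qed.

(** The second-order Taylor remainder of w^n, by induction on n.  The factor
    rho^2 on the left avoids the exponent n - 2. *)
Lemma Cpow_remainder (w h : C) (rho : R) (n : nat) :
  Cmod w <= rho -> Cmod (w + h) <= rho ->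
  rho ^ 2 * Cmod ((w + h) ^ n - w ^ n - h * (INR n * w ^ (pred n)))
    <= Cmod h ^ 2 * INR n ^ 2 * rho ^ n.
Proof.
intros Hw Hwh.
assert (Hrho : 0 <= rho) by (eapply Rle_trans; [apply (Cmod_ge_0 w)|easy]).
induction n as [|n IH].
- replace ((w + h) ^ 0 - w ^ 0 - h * (INR 0 * w ^ (pred 0)))%C with (RtoC 0)
    by (simpl; ring).
  rewrite Cmod_0; simpl; lra.
- assert (Hx : ((w + h) ^ S n - w ^ S n - h * (INR (S n) * w ^ (pred (S n))) =
    (h * h) * (INR n * w ^ (pred n)) +
    (w + h) * ((w + h) ^ n - w ^ n - h * (INR n * w ^ (pred n))))%C).
  { rewrite S_INR, RtoC_plus, !Cpow_S. simpl pred.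
    destruct n as [|n]; [simpl; ring|].
    rewrite S_INR, RtoC_plus. simpl pred. rewrite !Cpow_S. ring. }
  rewrite Hx.
  set (E := ((w + h) ^ n - w ^ n - h * (INR n * w ^ (pred n)))%C) in *.
  apply Rle_trans with (rho ^ 2 * (Cmod h ^ 2 * (INR n * rho ^ (pred n)) + rho * Cmod E)).
  { apply Rmult_le_compat_l; [apply pow2_ge_0|].
    eapply Rle_trans; [apply Cmod_triangle|].
    apply Rplus_le_compat.
    - rewrite !Cmod_mult, Cmod_R, Cmod_pow, Rabs_pos_eq by apply pos_INR.
      replace (Cmod h * Cmod h) with (Cmod h ^ 2) by ring.
      apply Rmult_le_compat_l; [apply pow2_ge_0|].
      apply Rmult_le_compat_l; [apply pos_INR|].
      apply pow_incr; split; [apply Cmod_ge_0|easy].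
    - rewrite Cmod_mult. apply Rmult_le_compat_r; [apply Cmod_ge_0|easy]. }
  assert (H1 : rho ^ 2 * (INR n * rho ^ pred n) <= INR n * rho ^ S n).
  { destruct n as [|n]; [simpl; lra|]. simpl pred.
    rewrite <- !tech_pow_Rmult. simpl. apply Req_le; ring. }
  assert (H2 : 0 <= Cmod h ^ 2) by apply pow2_ge_0.
  assert (H3 : 0 <= rho ^ S n) by (apply pow_le; easy).
  apply Rle_trans with
    (Cmod h ^ 2 * (INR n * rho ^ S n) + rho * (Cmod h ^ 2 * INR n ^ 2 * rho ^ n)).
  { apply Rle_trans with (Cmod h ^ 2 * (rho ^ 2 * (INR n * rho ^ pred n))
       + rho * (rho ^ 2 * Cmod E)); [apply Req_le; ring|].
    apply Rplus_le_compat; apply Rmult_le_compat_l; auto. }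
  rewrite S_INR. change (rho ^ S n) with (rho * rho ^ n) in *.
  generalize (pos_INR n); intros Hn.
  assert (H4 : 0 <= Cmod h ^ 2 * (rho * rho ^ n)) by (apply Rmult_le_pos; easy).
  assert (H5 : 0 <= Cmod h ^ 2 * (rho * rho ^ n) * (INR n + 1))
    by (apply Rmult_le_pos; lra).
  apply Rminus_le_0. eapply Rle_trans; [exact H5|]. apply Req_le; ring.
Qed.

Lemma is_series_norm_le (x : nat -> C) (l : C) (b : nat -> R) :
  @is_series C_AbsRing C_NormedModule x l ->
  (forall n, Cmod (x n) <= b n) -> ex_series b -> Cmod l <= Series b.
Proof.
intros Hx Hb Eb.
assert (H1 : is_lim_seq (fun n => Cmod (sum_n x n)) (Cmod l)).
{ unfold is_lim_seq.
  apply (filterlim_comp _ _ _ (sum_n x) Cmod eventually (locally l)).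
  - exact Hx.
  - apply (@filterlim_norm C_AbsRing C_NormedModule l). }
assert (H2 : is_lim_seq (sum_n b) (Series b)) by (apply Series_correct; easy).
refine (is_lim_seq_le (fun n => Cmod (sum_n x n)) (sum_n b) (Cmod l) (Series b) _ H1 H2).
intros n; induction n as [|n IH].
- rewrite !sum_O. apply Hb.
- rewrite !sum_Sn. eapply Rle_trans; [apply Cmod_triangle|].
  apply Rplus_le_compat; [exact IH|apply Hb].
Qed.

Lemma pow_n_Cpow (w : C) (n : nat) : @pow_n C_Ring w n = (w ^ n)%C.
Proof. induction n as [|n IH]; [easy|]. simpl. rewrite IH. easy. Qed.

Lemma is_series_bounded (x : nat -> C) (l : C) :
  @is_series C_AbsRing C_NormedModule x l -> exists B, 0 < B /\ forall n, Cmod (x n) <= B.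
Proof.
intros Hx.
assert (H1 : is_lim_seq (fun n => Cmod (sum_n x n)) (Cmod l)).
{ unfold is_lim_seq.
  apply (filterlim_comp _ _ _ (sum_n x) Cmod eventually (locally l)).
  - exact Hx.
  - apply (@filterlim_norm C_AbsRing C_NormedModule l). }
assert (H3 : exists M, forall n, Cmod (sum_n x n) <= M).
{ assert (H4 : Un_cv (fun n => Cmod (sum_n x n)) (Cmod l))
    by (apply is_lim_seq_Reals; exact H1).
  destruct (maj_by_pos _ (exist _ _ H4)) as [M [_ HM]].
  exists M. intros n. eapply Rle_trans; [apply Rle_abs|]. apply HM. }
destruct H3 as [M HM].
exists (2 * M + 1). 
assert (HM0 : 0 <= M) by (eapply Rle_trans; [apply Cmod_ge_0|apply (HM 0%nat)]).
split; [lra|].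
intros [|n].
- generalize (HM 0%nat). rewrite sum_O. lra.
- assert (Hs : x (S n) = (sum_n x (S n) - sum_n x n)%C).
  { rewrite sum_Sn. unfold plus; simpl. ring. }
  rewrite Hs. eapply Rle_trans; [apply Cmod_triangle|]. rewrite Cmod_opp.
  generalize (HM n) (HM (S n)); lra.
Qed.

Definition pseries_on_disc (a : nat -> C) (r : R) (f : C -> C) (z : C) : Prop :=
  forall w : C, Cmod (w - z) < r ->
    @is_pseries C_AbsRing C_NormedModule a (Cminus w z) (f w).

(** Term-by-term differentiation.  On a disc eight times smaller the
    coefficients satisfy |a_n| rho^n <= B / 4^n, so the remainders of
    [Cpow_remainder] add up to at most a constant times |h|^2.  The derivative is
    the total function [C_derive f], so the lemma can be iterated, and local
    derivatives obtained around different centres agree. *)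
Lemma pseries_C_derive (a : nat -> C) (r : R) (f : C -> C) (z : C) :
  0 < r -> pseries_on_disc a r f z ->
  pseries_on_disc (fun n => INR (S n) * a (S n))%C (r / 8) (C_derive f) z /\
  forall w : C, Cmod (w - z) < r / 8 -> is_C_derive f w (C_derive f w).
Proof.
intros Hr Hf.
set (rho := r / 8).
assert (HB : exists B, 0 < B /\ forall n, Cmod (a n) * rho ^ n <= B * (/ 4) ^ n).
{ assert (Hw : Cmod (z + RtoC (r / 2) - z) < r).
  { replace (z + RtoC (r / 2) - z)%C with (RtoC (r / 2)) by ring.
    rewrite Cmod_R, Rabs_pos_eq; lra. }
  destruct (is_series_bounded _ _ (Hf _ Hw)) as [B [HB0 HB]].
  exists B; split; [easy|]. intros n.
  generalize (HB n). unfold scal; simpl; unfold mult; simpl.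
  rewrite pow_n_Cpow, Cmod_mult.
  replace (z + RtoC (r / 2) - z)%C with (RtoC (r / 2)) by ring.
  rewrite Cmod_pow, Cmod_R, Rabs_pos_eq by lra.
  replace (r / 2) with (4 * rho) by (unfold rho; field).
  rewrite Rpow_mult_distr. intros H.
  rewrite pow_inv.
  apply Rmult_le_reg_r with (4 ^ n); [apply pow_lt; lra|].
  rewrite (Rmult_assoc B), Rinv_l by (apply pow_nonzero; lra). lra. }
destruct HB as [B [HB0 HB]].
assert (Hrho : 0 < rho) by (unfold rho; lra).
assert (Egeo : ex_series (fun n => (/ 2) ^ n)).
{ apply ex_series_geom. rewrite Rabs_pos_eq; lra. }
assert (H42 : forall n, 2 ^ n * (/ 4) ^ n = (/ 2) ^ n).
{ intros n. rewrite <- Rpow_mult_distr. f_equal. field. }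
assert (Hsq : forall n, INR n ^ 2 * (Cmod (a n) * rho ^ n) <= 3 * B * (/ 2) ^ n).
{ intros n. rewrite <- H42.
  apply Rle_trans with (3 * 2 ^ n * (B * (/ 4) ^ n)); [|apply Req_le; ring].
  apply Rmult_le_compat.
  - apply pow2_ge_0.
  - apply Rmult_le_pos; [apply Cmod_ge_0|apply pow_le; lra].
  - apply sqr_le_pow2.
  - apply HB. }
assert (Hmain : forall w, Cmod (w - z) < rho ->
   exists l, @is_pseries C_AbsRing C_NormedModule
      (fun n => INR (S n) * a (S n))%C (Cminus w z) l /\ is_C_derive f w l).
{ intros w Hw. set (u := Cminus w z).
  assert (El : exists l : C, @is_series C_AbsRing C_NormedModule
      (fun n => pow_n u n * (INR (S n) * a (S n)))%C l).
  { apply (ex_series_le (V := C_CompleteNormedModule)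
      (fun n => scal (@pow_n C_Ring u n) (INR (S n) * a (S n))%C : C)
      (fun n => 3 * B / rho * (/ 2) ^ S n)).
  { intros n. change (Cmod (pow_n u n * (INR (S n) * a (S n)))%C
       <= 3 * B / rho * (/ 2) ^ S n).
    rewrite pow_n_Cpow, !Cmod_mult, Cmod_pow, Cmod_R, Rabs_pos_eq by apply pos_INR.
    apply Rle_trans with (rho ^ n * (INR (S n) * Cmod (a (S n)))).
    { apply Rmult_le_compat_r.
      - apply Rmult_le_pos; [apply pos_INR|apply Cmod_ge_0].
      - apply pow_incr; split; [apply Cmod_ge_0|unfold u; lra]. }
    apply Rmult_le_reg_r with rho; [easy|].
    replace (3 * B / rho * (/ 2) ^ S n * rho) with (3 * B * (/ 2) ^ S n)
      by (field; lra).
    eapply Rle_trans; [|apply Hsq].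
    replace (rho ^ n * (INR (S n) * Cmod (a (S n))) * rho) with
      (INR (S n) * (Cmod (a (S n)) * rho ^ S n))
      by (change (rho ^ S n) with (rho * rho ^ n); ring).
    apply Rmult_le_compat_r.
    - apply Rmult_le_pos; [apply Cmod_ge_0|apply pow_le; lra].
    - rewrite S_INR. generalize (pos_INR n); nra. }
  { apply (ex_series_scal (V := R_NormedModule) (3 * B / rho)).
    apply (ex_series_incr_1 (fun n => (/ 2) ^ n)) in Egeo. exact Egeo. } }
  destruct El as [l Hl].
  exists l; split; [exact Hl|].
  apply is_C_derive_eps. intros eps Heps.
  (* The remainder is bounded by K |h|^2. *)
  set (K := 6 * B / rho ^ 2).
  assert (Hr2 : 0 < rho ^ 2) by (apply pow_lt; easy).
  assert (HK : 0 < K) by (unfold K; apply Rdiv_lt_0_compat; lra).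
  exists (Rmin (rho - Cmod u) (eps / K)).
  split.
  { apply Rmin_pos; [unfold u; lra|apply Rdiv_lt_0_compat; easy]. }
  intros w' Hw'.
  assert (Hw1 : Cmod (w' - w) < rho - Cmod u)
    by (eapply Rlt_le_trans; [exact Hw'|apply Rmin_l]).
  assert (Hw2 : Cmod (w' - w) < eps / K)
    by (eapply Rlt_le_trans; [exact Hw'|apply Rmin_r]).
  set (h := (w' - w)%C) in *.
  assert (Huh : Cmod (u + h) < rho)
    by (eapply Rle_lt_trans; [apply Cmod_triangle|lra]).
  assert (Hu' : (w' - z = u + h)%C) by (unfold u, h; ring).
  assert (Hf' : @is_series C_AbsRing C_NormedModule
     (fun n => a n * ((u + h) ^ n - u ^ n - h * (INR n * u ^ pred n)))%C
     (f w' - f w - l * h)%C).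
  { assert (S1 : @is_series C_AbsRing C_NormedModule
       (fun n => (u + h) ^ n * a n)%C (f w')).
    { assert (Hz : Cmod (w' - z) < r) by (rewrite Hu'; unfold rho in *; lra).
      eapply is_series_ext; [|exact (Hf w' Hz)].
      intros n. simpl. rewrite pow_n_Cpow.
      unfold scal; simpl; unfold mult; simpl.
      replace (Cminus w' z) with (u + h)%C by (symmetry; exact Hu'). easy. }
    assert (S2 : @is_series C_AbsRing C_NormedModule
       (fun n => u ^ n * a n)%C (f w)).
    { assert (Hz : Cmod (w - z) < r) by (unfold rho in *; lra).
      eapply is_series_ext; [|exact (Hf w Hz)].
      intros n. simpl. rewrite pow_n_Cpow. easy. }
    assert (S3 : @is_series C_AbsRing C_NormedModule
       (fun n => h * (INR n * a n * u ^ pred n))%C (h * l)%C).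
    { apply (@is_series_scal C_AbsRing C_NormedModule h).
      apply is_series_decr_1.
      match goal with |- is_series _ ?L => replace L with l
        by (unfold plus, opp; simpl; ring) end.
      eapply is_series_ext; [|exact Hl].
      intros n. change (pow_n u n * (INR (S n) * a (S n)) = INR (S n) * a (S n) * u ^ n)%C.
      rewrite pow_n_Cpow. ring. }
    generalize (is_series_minus _ _ _ _ (is_series_minus _ _ _ _ S1 S2) S3).
    intros S4.
    replace (f w' - f w - l * h)%C with
      (@plus C_NormedModule (@plus C_NormedModule (f w') (@opp C_NormedModule (f w)))
         (@opp C_NormedModule (h * l)%C))
      by (unfold plus, opp; simpl; ring).
    eapply is_series_ext; [|exact S4].
    intros n. unfold plus, opp; simpl. ring. }
  apply Rle_trans with (Series (fun n => Cmod h ^ 2 * (3 * B / rho ^ 2) * (/ 2) ^ n)).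
  { apply (is_series_norm_le _ _ _ Hf').
    - intros n. rewrite Cmod_mult.
      assert (Hrem := Cpow_remainder u h rho n (Rlt_le _ _ Hw) (Rlt_le _ _ Huh)).
      apply Rmult_le_reg_l with (rho ^ 2); [easy|].
      replace (rho ^ 2 * (Cmod h ^ 2 * (3 * B / rho ^ 2) * (/ 2) ^ n)) with
        (Cmod h ^ 2 * (3 * B * (/ 2) ^ n)) by (field; lra).
      apply Rle_trans with (Cmod (a n) * (Cmod h ^ 2 * INR n ^ 2 * rho ^ n)).
      + rewrite <- Rmult_assoc, (Rmult_comm (rho ^ 2)), Rmult_assoc.
        apply Rmult_le_compat_l; [apply Cmod_ge_0|exact Hrem].
      + replace (Cmod (a n) * (Cmod h ^ 2 * INR n ^ 2 * rho ^ n)) with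
          (Cmod h ^ 2 * (INR n ^ 2 * (Cmod (a n) * rho ^ n))) by ring.
        apply Rmult_le_compat_l; [apply pow2_ge_0|apply Hsq].
    - apply (ex_series_scal (V := R_NormedModule)). exact Egeo. }
  rewrite Series_scal_l, Series_geom by (rewrite Rabs_pos_eq; lra).
  replace (Cmod h ^ 2 * (3 * B / rho ^ 2) * / (1 - / 2)) with (K * Cmod h * Cmod h)
    by (unfold K; field; lra).
  apply Rmult_le_compat_r; [apply Cmod_ge_0|].
  apply Rmult_lt_compat_l with (r := K) in Hw2; [|easy].
  replace (K * (eps / K)) with eps in Hw2 by (field; lra). lra. }
split.
- intros w Hw. destruct (Hmain w Hw) as [l [Hl Hd]].
  rewrite (is_C_derive_unique _ _ _ Hd). exact Hl.
- intros w Hw. destruct (Hmain w Hw) as [l [Hl Hd]].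
  rewrite (is_C_derive_unique _ _ _ Hd). exact Hd.
Qed.

Lemma pseries_C_derive3 (a : nat -> C) (r : R) (f : C -> C) (z : C) :
  0 < r -> pseries_on_disc a r f z ->
  exists r' : R, 0 < r' /\ forall w : C, Cmod (w - z) < r' ->
    is_C_derive f w (C_derive f w) /\
    is_C_derive (C_derive f) w (C_derive (C_derive f) w) /\
    is_C_derive (C_derive (C_derive f)) w (C_derive (C_derive (C_derive f)) w).
Proof.
intros Hr H0.
destruct (pseries_C_derive _ _ _ _ Hr H0) as [H1 D1].
assert (Hr1 : 0 < r / 8) by lra.
destruct (pseries_C_derive _ _ _ _ Hr1 H1) as [H2 D2].
assert (Hr2 : 0 < r / 8 / 8) by lra.
destruct (pseries_C_derive _ _ _ _ Hr2 H2) as [H3 D3].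
exists (r / 8 / 8 / 8); split; [lra|].
intros w Hw; split; [|split]; [apply D1|apply D2|apply D3]; lra.
Qed.

(** * Complex differentiation rules and the logarithm of a modulus *)

(** The two normed-module structures on C have the same norm but different
    balls; the product and chain rules are stated for one, [C_derive] for the
    other. *)
Lemma is_C_derive_AbsRing (f : C -> C) (z d : C) :
  @is_derive C_AbsRing (AbsRing_NormedModule C_AbsRing) f z d <-> is_C_derive f z d.
Proof. split; intros [_ H]; (split; [apply is_linear_scal_l|exact H]). Qed.

Lemma is_C_derive_mult (f g : C -> C) (z df dg : C) :
  is_C_derive f z df -> is_C_derive g z dg ->
  is_C_derive (fun w => f w * g w)%C z (df * g z + f z * dg)%C.
Proof.
rewrite <- !is_C_derive_AbsRing. intros Hf Hg.
apply (is_derive_mult (K := C_AbsRing) f g z df dg Hf Hg). intros n m; apply Cmult_comm.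
Qed.

Lemma is_C_derive_comp (f g : C -> C) (z df dg : C) :
  is_C_derive f (g z) df -> is_C_derive g z dg -> is_C_derive (fun w => f (g w)) z (dg * df)%C.
Proof.
rewrite <- (is_C_derive_AbsRing g). intros Hf Hg.
apply (is_derive_comp (K := C_AbsRing) f g z df dg Hf Hg).
Qed.

Lemma is_C_derive_inv (z : C) : z <> 0 -> is_C_derive Cinv z (- / (z * z))%C.
Proof.
intros Hz. apply is_C_derive_eps. intros eps Heps.
assert (Hm : 0 < Cmod z) by (apply Cmod_gt_0; easy).
assert (Hm3 : 0 < Cmod z ^ 3) by (apply pow_lt; easy).
exists (Rmin (Cmod z / 2) (eps * Cmod z ^ 3 / 2)). split.
{ apply Rmin_pos; [lra|]. generalize (Rmult_lt_0_compat _ _ Heps Hm3); lra. }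
intros w Hw.
assert (Hw1 := Rlt_le_trans _ _ _ Hw (Rmin_l _ _)).
assert (Hw2 := Rlt_le_trans _ _ _ Hw (Rmin_r _ _)).
assert (Hwz : Cmod z / 2 < Cmod w).
{ assert (Ht := Cmod_triangle w (z - w)).
  replace (w + (z - w))%C with z in Ht by ring.
  replace (z - w)%C with (- (w - z))%C in Ht by ring. rewrite Cmod_opp in Ht. lra. }
assert (Hw0 : w <> 0) by (apply Cmod_gt_0; lra).
replace (/ w - / z - - / (z * z) * (w - z))%C with ((w - z) * (w - z) * / (w * (z * z)))%C
  by (field; split; easy).
rewrite !Cmod_mult, Cmod_inv, !Cmod_mult
  by (repeat apply Cmult_neq_0; easy).
set (h := Cmod (w - z)) in *.
assert (Hh : 0 <= h) by apply Cmod_ge_0.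
apply Rmult_le_reg_r with (Cmod w * (Cmod z * Cmod z)).
{ repeat apply Rmult_lt_0_compat; lra. }
rewrite Rmult_assoc, Rinv_l, Rmult_1_r.
2:{ apply Rgt_not_eq. repeat apply Rmult_lt_0_compat; lra. }
rewrite (Rmult_comm eps), Rmult_assoc.
apply Rmult_le_compat_l; [easy|].
apply Rle_trans with (eps * (Cmod z / 2 * (Cmod z * Cmod z))); [simpl in Hw2; lra|].
apply Rmult_le_compat_l; [lra|]. apply Rmult_le_compat_r; [nra|lra].
Qed.

Lemma Rmax_le_Cmod (x y : R) : Rmax (Rabs x) (Rabs y) <= Cmod (x, y).
Proof. apply (Rmax_Cmod (x, y)). Qed.

Lemma Cmod_le_2Rmax (x y : R) : Cmod (x, y) <= 2 * Rmax (Rabs x) (Rabs y).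
Proof.
eapply Rle_trans; [apply Cmod_2Rmax|]. simpl.
apply Rmult_le_compat_r.
- eapply Rle_trans; [apply Rabs_pos|apply Rmax_l].
- rewrite <- (sqrt_pow2 2) at 2 by lra. apply sqrt_le_1_alt; lra.
Qed.

Lemma im_le_Cmod (c : C) : Rabs (Im c) <= Cmod c.
Proof. eapply Rle_trans; [apply Rmax_r|apply Rmax_Cmod]. Qed.

(** The Cauchy-Riemann equations, in both directions. *)
Lemma is_C_derive_differentiable (f : C -> C) (x y : R) (d : C) :
  is_C_derive f (x, y) d ->
  differentiable_pt_lim (fun u v => Re (f (u, v))) x y (Re d) (- Im d) /\
  differentiable_pt_lim (fun u v => Im (f (u, v))) x y (Im d) (Re d).
Proof.
intros Hf. rewrite is_C_derive_eps in Hf.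
assert (H : forall eps : posreal, locally_2d (fun u v =>
  Cmod (f (u, v) - f (x, y) - d * ((u, v) - (x, y)))
    <= eps * Rmax (Rabs (u - x)) (Rabs (v - y))) x y).
{ intros eps. destruct (Hf (eps / 2)) as [delta [Hd H]];
    [generalize (cond_pos eps); lra|].
  assert (Hd2 : 0 < delta / 2) by lra.
  exists (mkposreal _ Hd2). simpl. intros u v Hu Hv.
  assert (Hc := Cmod_le_2Rmax (u - x) (v - y)).
  assert (Hm : Rmax (Rabs (u - x)) (Rabs (v - y)) < delta / 2) by (apply Rmax_lub_lt; easy).
  eapply Rle_trans; [apply H|].
  - change ((u, v) - (x, y))%C with (u - x, v - y). lra.
  - change ((u, v) - (x, y))%C with (u - x, v - y).
    generalize (cond_pos eps); nra. }
split; intros eps; destruct (H eps) as [delta Hd]; exists delta; intros u v Hu Hv;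
  (eapply Rle_trans; [|exact (Hd u v Hu Hv)]).
- eapply Rle_trans; [|apply re_le_Cmod]. apply Req_le. f_equal.
  unfold Re, Im; simpl. ring.
- eapply Rle_trans; [|apply im_le_Cmod]. apply Req_le. f_equal.
  unfold Re, Im; simpl. ring.
Qed.

Lemma differentiable_is_C_derive (f : C -> C) (x y : R) (d : C) :
  differentiable_pt_lim (fun u v => Re (f (u, v))) x y (Re d) (- Im d) ->
  differentiable_pt_lim (fun u v => Im (f (u, v))) x y (Im d) (Re d) ->
  is_C_derive f (x, y) d.
Proof.
intros H1 H2. apply is_C_derive_eps. intros eps Heps.
assert (He : 0 < eps / 2) by lra.
destruct (H1 (mkposreal _ He)) as [d1 Hd1].
destruct (H2 (mkposreal _ He)) as [d2 Hd2]. simpl in Hd1, Hd2.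
exists (Rmin d1 d2). split; [apply Rmin_pos; apply cond_pos|].
intros [u v] Hw.
change ((u, v) - (x, y))%C with (u - x, v - y) in *.
assert (Hm := Rmax_le_Cmod (u - x) (v - y)).
assert (Hu := Rle_trans _ _ _ (Rmax_l _ _) Hm).
assert (Hv := Rle_trans _ _ _ (Rmax_r _ _) Hm).
assert (Hw1 := Rlt_le_trans _ _ _ Hw (Rmin_l _ _)).
assert (Hw2 := Rlt_le_trans _ _ _ Hw (Rmin_r _ _)).
assert (G1 := Hd1 u v ltac:(lra) ltac:(lra)).
assert (G2 := Hd2 u v ltac:(lra) ltac:(lra)).
set (c := (f (u, v) - f (x, y) - d * ((u - x)%R, (v - y)%R))%C).
rewrite (surjective_pairing c).
eapply Rle_trans; [apply Cmod_le_2Rmax|].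
assert (Rmax (Rabs (fst c)) (Rabs (snd c)) <= eps / 2 * Rmax (Rabs (u - x)) (Rabs (v - y))).
{ apply Rmax_lub.
  - replace (fst c) with (Re (f (u, v)) - Re (f (x, y)) - (Re d * (u - x) + - Im d * (v - y)));
      [exact G1|unfold c, Re, Im; simpl; ring].
  - replace (snd c) with (Im (f (u, v)) - Im (f (x, y)) - (Im d * (u - x) + Re d * (v - y)));
      [exact G2|unfold c, Re, Im; simpl; ring]. }
nra.
Qed.

Lemma differentiable_pt_lim_proj2 (f : R -> R) (x y l : R) :
  derivable_pt_lim f y l -> differentiable_pt_lim (fun _ v => f v) x y 0 l.
Proof.
intros Hf eps.
destruct (differentiable_pt_lim_proj1_0 f y x l Hf eps) as [delta H].
exists delta. intros u v Hu Hv. generalize (H v u Hv Hu).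
rewrite Rmax_comm. intros H'. eapply Rle_trans; [|exact H']. apply Req_le; f_equal; ring.
Qed.

Lemma differentiable_pt_lim_Rmult (x y : R) :
  differentiable_pt_lim Rmult x y y x.
Proof.
intros eps. exists eps. intros u v Hu Hv.
replace (u * v - x * y - (y * (u - x) + x * (v - y))) with ((u - x) * (v - y)) by ring.
rewrite Rabs_mult. apply Rmult_le_compat; try apply Rabs_pos; [lra|apply Rmax_r].
Qed.

(** The complex exponential, written with [polar] so that its values are the
    points of a curved sector. *)
Definition cexp (z : C) : C := polar (exp (fst z)) (snd z).

Lemma is_C_derive_cexp (z : C) : is_C_derive cexp z (cexp z).
Proof.
destruct z as [x y]. apply differentiable_is_C_derive.
- unfold cexp, polar, Re, Im; simpl.
  replace (exp x * cos y) with (cos y * exp x + exp x * 0) by ring.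
  replace (- (exp x * sin y)) with (cos y * 0 + exp x * (- sin y)) by ring.
  apply (differentiable_pt_lim_comp Rmult (fun u _ => exp u) (fun _ v => cos v)).
  + apply differentiable_pt_lim_Rmult.
  + apply differentiable_pt_lim_proj1_0, derivable_pt_lim_exp.
  + apply differentiable_pt_lim_proj2, derivable_pt_lim_cos.
- unfold cexp, polar, Re, Im; simpl.
  replace (exp x * sin y) with (sin y * exp x + exp x * 0) by ring.
  replace (exp x * cos y) with (sin y * 0 + exp x * (cos y)) by ring.
  apply (differentiable_pt_lim_comp Rmult (fun u _ => exp u) (fun _ v => sin v)).
  + apply differentiable_pt_lim_Rmult.
  + apply differentiable_pt_lim_proj1_0, derivable_pt_lim_exp.
  + apply differentiable_pt_lim_proj2, derivable_pt_lim_sin.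
Qed.

Lemma differentiable_ln_norm (a b : R) : 0 < a ^ 2 + b ^ 2 ->
  differentiable_pt_lim (fun u v => ln (Cmod (u, v))) a b
    (a / (a ^ 2 + b ^ 2)) (b / (a ^ 2 + b ^ 2)).
Proof.
intros Hab.
assert (H1 : derivable_pt_lim (fun t => ln (sqrt t)) (a ^ 2 + b ^ 2) (/ (2 * (a ^ 2 + b ^ 2)))).
{ apply is_derive_Reals. auto_derive.
  - split; [easy|]. split; [apply sqrt_lt_R0; easy|easy].
  - assert (Hs := sqrt_lt_R0 _ Hab).
    assert (Hq : sqrt (a ^ 2 + b ^ 2) * sqrt (a ^ 2 + b ^ 2) = a ^ 2 + b ^ 2)
      by (apply sqrt_sqrt; lra).
    rewrite <- Hq at 3. field. lra. }
replace (a / (a ^ 2 + b ^ 2)) with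
  (/ (2 * (a ^ 2 + b ^ 2)) * (2 * a) + 0 * (2 * a)) by (field; lra).
replace (b / (a ^ 2 + b ^ 2)) with
  (/ (2 * (a ^ 2 + b ^ 2)) * (2 * b) + 0 * (2 * b)) by (field; lra).
assert (H2 : differentiable_pt_lim (fun u v => u ^ 2 + v ^ 2) a b (2 * a) (2 * b)).
{ intros eps.
  assert (He : 0 < eps / 2) by (generalize (cond_pos eps); lra).
  exists (mkposreal _ He). simpl. intros u v Hu Hv.
  replace (u * (u * 1) + v * (v * 1) - (a * (a * 1) + b * (b * 1)) -
    (2 * a * (u - a) + 2 * b * (v - b))) with ((u - a) * (u - a) + (v - b) * (v - b)) by ring.
  eapply Rle_trans; [apply Rabs_triang|]. rewrite !Rabs_mult.
  generalize (Rmax_l (Rabs (u - a)) (Rabs (v - b))) (Rmax_r (Rabs (u - a)) (Rabs (v - b)))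
    (Rabs_pos (u - a)) (Rabs_pos (v - b)). nra. }
apply (differentiable_pt_lim_comp (fun t _ => ln (sqrt t)) (fun u v => u ^ 2 + v ^ 2)
  (fun u v => u ^ 2 + v ^ 2) a b).
- apply differentiable_pt_lim_proj1_0. exact H1.
- exact H2.
- exact H2.
Qed.

(** d ln |g| = Re (g'/g dz), obtained without a logarithm of g. *)
Lemma differentiable_ln_Cmod (g : C -> C) (x y : R) (d : C) :
  is_C_derive g (x, y) d -> g (x, y) <> 0 ->
  differentiable_pt_lim (fun u v => ln (Cmod (g (u, v)))) x y
    (Re (d / g (x, y))) (- Im (d / g (x, y))).
Proof.
intros Hg H0.
destruct (is_C_derive_differentiable _ _ _ _ Hg) as [H1 H2].
assert (Hp : 0 < Re (g (x, y)) ^ 2 + Im (g (x, y)) ^ 2).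
{ rewrite <- Cmod2_alt. apply pow_lt, Cmod_gt_0, H0. }
assert (H3 := differentiable_ln_norm _ _ Hp).
assert (H4 := differentiable_pt_lim_comp _ _ _ _ _ _ _ _ _ _ _ H3 H1 H2).
unfold Cdiv.
replace (Re (d * / g (x, y))) with (Re (g (x, y)) / (Re (g (x, y)) ^ 2 + Im (g (x, y)) ^ 2) * Re d +
     Im (g (x, y)) / (Re (g (x, y)) ^ 2 + Im (g (x, y)) ^ 2) * Im d).
2:{ unfold Re, Im, Cinv in *; simpl in *. field. lra. }
replace (- Im (d * / g (x, y))) with (Re (g (x, y)) / (Re (g (x, y)) ^ 2 + Im (g (x, y)) ^ 2) * - Im d +
     Im (g (x, y)) / (Re (g (x, y)) ^ 2 + Im (g (x, y)) ^ 2) * Re d).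
2:{ unfold Re, Im, Cinv in *; simpl in *. field. lra. }
eapply differentiable_pt_lim_ext; [|exact H4].
apply locally_2d_forall. intros u v. simpl.
unfold Re, Im. rewrite <- surjective_pairing. easy.
Qed.

(** Harmonicity of h at a point, in the form in which it is used: the gradient of
    h comes from a complex differentiable function phi = h_x - i h_y, and
    dphi = phi' is again complex differentiable, hence continuous.  The second
    partial derivatives of h are then the components of dphi:
    h_xx = Re dphi = - h_yy and h_xy = - Im dphi. *)
Definition harmonic_at (h : R -> R -> R) (phi dphi : C -> C) (x y : R) : Prop :=
  differentiable_pt_lim h x y (Re (phi (x, y))) (- Im (phi (x, y))) /\
  is_C_derive phi (x, y) (dphi (x, y)) /\
  ex_derive (K := C_AbsRing) (V := C_NormedModule) dphi (x, y).

(** phi is the logarithmic derivative E G'(E) / G(E) of G o exp, where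
    E = exp (s + i t).  Analyticity at every point of the closed sector includes
    a full neighbourhood, hence boundary points are allowed. *)
Lemma log_modulus_harmonic (D : C -> Prop) (G : C -> C) :
  analytic_on D G -> (forall z, D z -> G z <> 0) ->
  exists phi dphi : C -> C, forall s t : R, D (cexp (s, t)) ->
    harmonic_at (fun s t => ln (Cmod (G (polar (exp s) t)))) phi dphi s t.
Proof.
intros HG HG0.
set (G1 := C_derive G). set (G2 := C_derive G1).
exists (fun z => cexp z * G1 (cexp z) * / G (cexp z))%C.
exists (fun z =>
   (cexp z * G1 (cexp z) + cexp z * (cexp z * G2 (cexp z))) * / G (cexp z)
   + (cexp z * G1 (cexp z)) * (cexp z * G1 (cexp z) * - / (G (cexp z) * G (cexp z))))%C.
intros s t Hst.
destruct (HG _ Hst) as [a [r [Hr Ha]]].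
destruct (pseries_C_derive3 a r G (cexp (s, t)) Hr Ha) as [r' [Hr' H]].
destruct (H (cexp (s, t))) as [D1 [D2 D3]].
{ replace (cexp (s, t) - cexp (s, t))%C with (RtoC 0) by ring. rewrite Cmod_0; easy. }
fold G1 in D1, D2, D3. fold G2 in D2, D3.
assert (N0 := HG0 _ Hst).
assert (E0 := is_C_derive_cexp (s, t)).
assert (C0 := is_C_derive_comp _ _ _ _ _ D1 E0).
assert (C1 := is_C_derive_comp _ _ _ _ _ D2 E0).
assert (C2 := is_C_derive_comp _ _ _ _ _ D3 E0).
assert (I0 := is_C_derive_comp _ _ _ _ _ (is_C_derive_inv _ N0) C0).
assert (M1 := is_C_derive_mult _ _ _ _ _ E0 C1).
assert (M2 := is_C_derive_mult _ _ _ _ _ E0 C2).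
split; [|split].
- exact (differentiable_ln_Cmod (fun z => G (cexp z)) s t _ C0 N0).
- exact (is_C_derive_mult _ _ _ _ _ M1 I0).
- assert (Q := is_C_derive_mult _ _ _ _ _
    (is_derive_plus _ _ _ _ _ M1 (is_C_derive_mult _ _ _ _ _ E0 M2)) I0).
  assert (Q1 := is_C_derive_mult _ _ _ _ _ C0 C0).
  assert (Q2 := is_C_derive_comp Cinv (fun w => G (cexp w) * G (cexp w))%C _ _ _
    (is_C_derive_inv _ (Cmult_neq_0 _ _ N0 N0)) Q1).
  assert (Q3 := is_C_derive_mult _ _ _ _ _ M1 (is_derive_opp _ _ _ Q2)).
  assert (Q4 := is_derive_plus _ _ _ _ _ Q (is_C_derive_mult _ _ _ _ _ M1 Q3)).
  eexists. exact Q4.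
Qed.

(** * Calculus for integrals with a parameter *)

Lemma continuity_2d_pt_slice (f : R -> R -> R) (x y : R) :
  continuity_2d_pt f x y -> continuous (f x) y.
Proof.
intros H. apply continuity_pt_filterlim.
intros eps He. destruct (H (mkposreal eps He)) as [delta Hd].
exists delta. split; [apply cond_pos|]. intros t [_ Ht].
apply Hd; [|exact Ht]. rewrite Rminus_diag, Rabs_R0. apply cond_pos.
Qed.

Lemma is_derive_RInt_open (f df : R -> R -> R) (x1 x2 c a b d : R) :
  c < a -> a <= b -> b < d ->
  (forall x t, x1 < x < x2 -> c < t < d ->
     is_derive (fun u => f u t) x (df x t) /\ continuity_2d_pt df x t /\
     continuous (f x) t) ->
  forall x, x1 < x < x2 ->
  is_derive (fun u => RInt (f u) a b) x (RInt (df x) a b).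
Proof.
intros Hca Hab Hbd H x Hx.
assert (Hloc : locally x (fun u => x1 < u < x2)).
{ apply filter_and; [apply open_gt|apply open_lt]; lra. }
replace (RInt (df x) a b) with (RInt (fun t => Derive (fun u => f u t) x) a b).
2:{ apply RInt_ext. rewrite Rmin_left, Rmax_right by easy. intros t Ht.
    apply is_derive_unique, H; lra. }
apply (is_derive_RInt_param (fun u t => f u t)).
- eapply filter_imp; [|exact Hloc]. intros u Hu t Ht.
  rewrite Rmin_left, Rmax_right in Ht by easy.
  exists (df u t). apply H; lra.
- intros t Ht. rewrite Rmin_left, Rmax_right in Ht by easy.
  apply continuity_2d_pt_ext_loc with df; [|apply H; lra].
  assert (Hd : 0 < Rmin (Rmin (x - x1) (x2 - x)) (Rmin (t - c) (d - t))).
  { repeat apply Rmin_pos; lra. }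
  exists (mkposreal _ Hd). simpl. intros u v Hu Hv.
  symmetry. apply is_derive_unique. apply H.
  + assert (G1 := Rlt_le_trans _ _ _ Hu (Rmin_l _ _)).
    assert (G2 := Rlt_le_trans _ _ _ G1 (Rmin_l _ _)).
    assert (G3 := Rlt_le_trans _ _ _ G1 (Rmin_r _ _)).
    apply Rabs_def2 in G2; apply Rabs_def2 in G3; lra.
  + assert (G1 := Rlt_le_trans _ _ _ Hv (Rmin_r _ _)).
    assert (G2 := Rlt_le_trans _ _ _ G1 (Rmin_l _ _)).
    assert (G3 := Rlt_le_trans _ _ _ G1 (Rmin_r _ _)).
    apply Rabs_def2 in G2; apply Rabs_def2 in G3; lra.
- eapply filter_imp; [|exact Hloc]. intros u Hu.
  apply (ex_RInt_continuous (V := R_CompleteNormedModule)).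
  rewrite Rmin_left, Rmax_right by easy. intros t Ht. apply H; lra.
Qed.

(** An integrand which is, up to a constant factor k, the derivative of a function
    with equal end values has integral zero.  On circles, periodicity supplies
    the equality of the end values, and k is 1 or minus the radius. *)
Lemma RInt_exact (F f : R -> R) (k a b : R) :
  a <= b -> k <> 0 -> F b = F a ->
  (forall t, a <= t <= b -> is_derive F t (k * f t)) ->
  (forall t, a <= t <= b -> continuous f t) -> RInt f a b = 0.
Proof.
intros Hab Hk HF H1 H2.
assert (Hi : is_RInt (fun t => k * f t) a b (minus (F b) (F a))).
{ apply (is_RInt_derive (V := R_CompleteNormedModule));
    rewrite Rmin_left, Rmax_right by easy; [easy|].
  intros t Ht. apply (continuous_scal_r k f t). apply H2, Ht. }
replace (minus (F b) (F a)) with 0 in Hi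
  by (rewrite HF; unfold minus, plus, opp; simpl; ring).
apply (is_RInt_scal _ _ _ (/ k)) in Hi.
apply Rmult_eq_reg_l with k; [|easy]. rewrite Rmult_0_r.
replace (RInt f a b) with (scal (/ k) 0); [unfold scal; simpl; unfold mult; simpl; ring|].
symmetry. apply is_RInt_unique. eapply is_RInt_ext; [|exact Hi].
intros t _. unfold scal; simpl; unfold mult; simpl. field. easy.
Qed.

(** The derivative is only assumed to vanish away from 0: in the applications it
    is computed after division by the radius. *)
Lemma eq_of_derive_0 (F dF : R -> R) (d : R) :
  (forall r, - d < r < d -> is_derive F r (dF r)) ->
  (forall r, 0 < r < d -> dF r = 0) ->
  forall r, 0 <= r < d -> F r = F 0.
Proof.
intros H1 H2 r [[Hr|<-] Hd]; [|easy].
destruct (MVT_cor2 F dF 0 r Hr) as [c [Hc Hc2]].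
- intros c Hc. apply is_derive_Reals, H1; lra.
- rewrite H2 in Hc by lra. lra.
Qed.

Lemma continuity_2d_pt_comp (f u v : R -> R -> R) (x y : R) :
  continuity_2d_pt f (u x y) (v x y) -> continuity_2d_pt u x y ->
  continuity_2d_pt v x y -> continuity_2d_pt (fun s t => f (u s t) (v s t)) x y.
Proof.
intros Hf Hu Hv eps. destruct (Hf eps) as [e H].
destruct (Hu e) as [d1 H1]. destruct (Hv e) as [d2 H2].
assert (Hd : 0 < Rmin d1 d2) by (apply Rmin_pos; apply cond_pos).
exists (mkposreal _ Hd). simpl. intros s t Hs Ht. apply H.
- apply H1; (eapply Rlt_le_trans; [eassumption|apply Rmin_l]).
- apply H2; (eapply Rlt_le_trans; [eassumption|apply Rmin_r]).
Qed.

Lemma is_derive_val (f : R -> R) (x l l' : R) :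
  is_derive f x l -> l = l' -> is_derive f x l'.
Proof. intros H <-. exact H. Qed.

Lemma is_derive_Rmult (f g : R -> R) (x df dg : R) :
  is_derive f x df -> is_derive g x dg ->
  is_derive (fun u => f u * g u) x (df * g x + f x * dg).
Proof. rewrite !is_derive_Reals. apply derivable_pt_lim_mult. Qed.

Lemma is_derive_Rplus (f g : R -> R) (x df dg : R) :
  is_derive f x df -> is_derive g x dg ->
  is_derive (fun u => f u + g u) x (df + dg).
Proof. rewrite !is_derive_Reals. apply derivable_pt_lim_plus. Qed.

Lemma is_derive_slice1 (f : R -> R -> R) (x y lx ly : R) :
  differentiable_pt_lim f x y lx ly -> is_derive (fun u => f u y) x lx.
Proof.
intros H. apply is_derive_Reals.
replace lx with (lx * 1 + ly * 0) by ring.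
apply (derivable_pt_lim_comp_2d f (fun u => u) (fun _ => y)); [exact H| |];
  apply is_derive_Reals; auto_derive; easy.
Qed.

Lemma is_derive_slice2 (f : R -> R -> R) (x y lx ly : R) :
  differentiable_pt_lim f x y lx ly -> is_derive (f x) y ly.
Proof.
intros H. apply is_derive_Reals.
replace ly with (lx * 0 + ly * 1) by ring.
apply (derivable_pt_lim_comp_2d f (fun _ => x) (fun v => v)); [exact H| |];
  apply is_derive_Reals; auto_derive; easy.
Qed.

(** * Circular means of harmonic functions *)

Definition on_circle (f : R -> R -> R) (x y r t : R) : R :=
  f (x + r * cos t) (y + r * sin t).

Lemma continuity_2d_cos (r t : R) : continuity_2d_pt (fun _ v => cos v) r t.
Proof.
apply (continuity_1d_2d_pt_comp cos (fun _ v => v)).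
- apply continuity_cos.
- apply continuity_2d_pt_id2.
Qed.

Lemma continuity_2d_sin (r t : R) : continuity_2d_pt (fun _ v => sin v) r t.
Proof.
apply (continuity_1d_2d_pt_comp sin (fun _ v => v)).
- apply continuity_sin.
- apply continuity_2d_pt_id2.
Qed.

Lemma continuity_2d_on_circle (f : R -> R -> R) (x y r t : R) :
  continuity_2d_pt f (x + r * cos t) (y + r * sin t) ->
  continuity_2d_pt (on_circle f x y) r t.
Proof.
intros Hf.
apply (continuity_2d_pt_comp f (fun r t => x + r * cos t) (fun r t => y + r * sin t)); auto.
- apply continuity_2d_pt_plus; [apply continuity_2d_pt_const|].
  apply continuity_2d_pt_mult; [apply continuity_2d_pt_id1|apply continuity_2d_cos].
- apply continuity_2d_pt_plus; [apply continuity_2d_pt_const|].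
  apply continuity_2d_pt_mult; [apply continuity_2d_pt_id1|apply continuity_2d_sin].
Qed.

Lemma is_derive_on_circle_r (f : R -> R -> R) (x y r t lx ly : R) :
  differentiable_pt_lim f (x + r * cos t) (y + r * sin t) lx ly ->
  is_derive (fun r => on_circle f x y r t) r (lx * cos t + ly * sin t).
Proof.
intros Hf. apply is_derive_Reals.
apply (derivable_pt_lim_comp_2d f (fun r => x + r * cos t) (fun r => y + r * sin t)); auto;
apply is_derive_Reals; auto_derive; auto; ring.
Qed.

Lemma is_derive_on_circle_t (f : R -> R -> R) (x y r t lx ly : R) :
  differentiable_pt_lim f (x + r * cos t) (y + r * sin t) lx ly ->
  is_derive (on_circle f x y r) t (lx * - (r * sin t) + ly * (r * cos t)).
Proof.
intros Hf. apply is_derive_Reals.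
apply (derivable_pt_lim_comp_2d f (fun t => x + r * cos t) (fun t => y + r * sin t)); auto;
apply is_derive_Reals; auto_derive; auto; ring.
Qed.

(** The real form of [harmonic_at]: the gradient of h is (a, -b), and its Hessian
    has the entries c, -e and -c. *)
Lemma harmonic_at_facts (h : R -> R -> R) (phi dphi : C -> C) (x y : R) :
  harmonic_at h phi dphi x y ->
  let a := fun u v => Re (phi (u, v)) in
  let b := fun u v => Im (phi (u, v)) in
  let c := fun u v => Re (dphi (u, v)) in
  let e := fun u v => Im (dphi (u, v)) in
  (differentiable_pt_lim h x y (a x y) (- b x y) /\
   differentiable_pt_lim a x y (c x y) (- e x y) /\
   differentiable_pt_lim b x y (e x y) (c x y)) /\
  (continuity_2d_pt h x y /\ continuity_2d_pt a x y /\ continuity_2d_pt b x y /\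
   continuity_2d_pt c x y /\ continuity_2d_pt e x y).
Proof.
intros [H1 [H2 [l H3]]] a b c e.
destruct (is_C_derive_differentiable _ _ _ _ H2) as [Ha Hb].
destruct (is_C_derive_differentiable _ _ _ _ H3) as [Hc He].
split; [easy|].
repeat split; apply differentiable_continuity_pt; eexists; eexists; eassumption.
Qed.

Lemma circle_in_disc (x y d r t : R) :
  - d < r < d -> (x + r * cos t - x) ^ 2 + (y + r * sin t - y) ^ 2 < d ^ 2.
Proof.
intros Hr. generalize (sin2_cos2 t). unfold Rsqr. intros H.
replace ((x + r * cos t - x) ^ 2 + (y + r * sin t - y) ^ 2) with
  (r ^ 2 * (sin t * sin t + cos t * cos t)) by ring.
rewrite H. nra.
Qed.

Ltac circle_cont :=
  repeat first
  [ assumption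
  | apply continuity_2d_pt_plus | apply continuity_2d_pt_minus
  | apply continuity_2d_pt_opp
  | apply continuity_2d_pt_mult | apply continuity_2d_pt_const
  | apply continuity_2d_cos | apply continuity_2d_sin
  | apply continuity_2d_pt_id1
  | (apply continuity_2d_on_circle; assumption) ].

Lemma continuity_2d_ex_RInt (f : R -> R -> R) (r a b : R) :
  (forall t, continuity_2d_pt f r t) -> ex_RInt (f r) a b.
Proof.
intros H. apply (ex_RInt_continuous (V := R_CompleteNormedModule)).
intros t _. apply continuity_2d_pt_slice, H.
Qed.

Lemma two_PI_pos : 0 < 2 * PI.
Proof. generalize PI_RGT_0; lra. Qed.

Lemma on_circle_periodic (f : R -> R -> R) (x y r : R) :
  on_circle f x y r (2 * PI) = on_circle f x y r 0.
Proof. unfold on_circle. rewrite cos_2PI, sin_2PI, cos_0, sin_0. easy. Qed.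

Lemma circle_mean_const (c : R) : RInt (fun _ => c) 0 (2 * PI) = 2 * PI * c.
Proof. rewrite RInt_const. unfold scal; simpl; unfold mult; simpl. ring. Qed.

Lemma RInt_zero (f : R -> R) (a b : R) : (forall t, f t = 0) -> RInt f a b = 0.
Proof.
intros H. rewrite (RInt_ext _ (fun _ => 0)) by (intros; apply H).
rewrite RInt_const. unfold scal; simpl; unfold mult; simpl. ring.
Qed.

(** Mean value property of Im phi: by Cauchy-Riemann the radial derivative of the
    integrand is -1/s times the angular derivative of Re phi. *)
Lemma mean_Im_gradient (h : R -> R -> R) (phi dphi : C -> C) (x y d r : R) :
  (forall u v, (u - x) ^ 2 + (v - y) ^ 2 < d ^ 2 -> harmonic_at h phi dphi u v) ->
  0 <= r < d ->
  RInt (on_circle (fun u v => Im (phi (u, v))) x y r) 0 (2 * PI) = 2 * PI * Im (phi (x, y)).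
Proof.
intros H Hr. assert (Hpi := two_PI_pos).
set (a := fun u v => Re (phi (u, v))). set (b := fun u v => Im (phi (u, v))).
set (c := fun u v => Re (dphi (u, v))). set (e := fun u v => Im (dphi (u, v))).
set (dF := fun r t => on_circle e x y r t * cos t + on_circle c x y r t * sin t).
assert (HF : forall r, - d < r < d ->
  is_derive (fun r => RInt (on_circle b x y r) 0 (2 * PI)) r (RInt (dF r) 0 (2 * PI))).
{ apply (is_derive_RInt_open _ _ _ _ (- 1) _ _ (2 * PI + 1)); try lra.
  intros s t Hs _.
  destruct (harmonic_at_facts _ _ _ _ _ (H _ _ (circle_in_disc x y d s t Hs)))
    as [[Dh [Da Db]] [Kh [Ka [Kb [Kc Ke]]]]].
  split; [|split].
  - apply is_derive_on_circle_r. exact Db.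
  - unfold dF. circle_cont.
  - apply continuity_2d_pt_slice. circle_cont. }
rewrite (eq_of_derive_0 _ _ d HF).
- rewrite <- circle_mean_const. apply RInt_ext. intros t _.
  unfold on_circle, b. rewrite !Rmult_0_l, !Rplus_0_r. easy.
- intros s Hs.
  apply (RInt_exact (on_circle a x y s) _ (- s)); [lra|lra|apply on_circle_periodic| |];
  intros t _;
  destruct (harmonic_at_facts _ _ _ _ _ (H _ _ (circle_in_disc x y d s t ltac:(lra))))
      as [[Dh [Da Db]] [Kh [Ka [Kb [Kc Ke]]]]].
  + replace (- s * dF s t) with
        (c (x + s * cos t) (y + s * sin t) * - (s * sin t)
         + - e (x + s * cos t) (y + s * sin t) * (s * cos t))
        by (unfold dF, on_circle; ring).
    apply is_derive_on_circle_t. exact Da.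
  + apply continuity_2d_pt_slice. unfold dF. circle_cont.
- exact Hr.
Qed.

(** Cauchy's theorem for phi on circles gives that the integral K of
    r Re (phi e^{it}) vanishes: it does so at r = 0, and its radial derivative is
    the integral of an angular derivative.  As r times the radial derivative of
    the mean of h is that integral, the mean of h is constant. *)
Lemma mean_value (h : R -> R -> R) (phi dphi : C -> C) (x y d r : R) :
  (forall u v, (u - x) ^ 2 + (v - y) ^ 2 < d ^ 2 -> harmonic_at h phi dphi u v) ->
  0 <= r < d ->
  RInt (on_circle h x y r) 0 (2 * PI) = 2 * PI * h x y.
Proof.
intros H Hr. assert (Hpi := two_PI_pos).
set (a := fun u v => Re (phi (u, v))). set (b := fun u v => Im (phi (u, v))).
set (c := fun u v => Re (dphi (u, v))). set (e := fun u v => Im (dphi (u, v))).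
set (dF := fun r t => on_circle a x y r t * cos t + - on_circle b x y r t * sin t).
set (K := fun r t => r * dF r t).
set (dK := fun r t => dF r t +
   r * ((on_circle c x y r t * cos t + - on_circle e x y r t * sin t) * cos t
        - (on_circle e x y r t * cos t + on_circle c x y r t * sin t) * sin t)).
assert (HK : forall r, - d < r < d ->
  is_derive (fun r => RInt (K r) 0 (2 * PI)) r (RInt (dK r) 0 (2 * PI))).
{ apply (is_derive_RInt_open _ _ _ _ (- 1) _ _ (2 * PI + 1)); try lra.
  intros s t Hs _.
  destruct (harmonic_at_facts _ _ _ _ _ (H _ _ (circle_in_disc x y d s t Hs)))
    as [[Dh [Da Db]] [Kh [Ka [Kb [Kc Ke]]]]].
  assert (D1 := is_derive_on_circle_r _ _ _ _ _ _ _ Da).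
  assert (D2 := is_derive_on_circle_r _ _ _ _ _ _ _ Db).
  split; [|split].
  - unfold K, dF, dK.
    assert (E1 := is_derive_Rmult _ _ _ _ _ (is_derive_id s) (is_derive_Rplus _ _ _ _ _
      (is_derive_Rmult _ _ _ _ _ D1 (is_derive_const (cos t) s))
      (is_derive_Rmult _ _ _ _ _ (is_derive_opp _ _ _ D2) (is_derive_const (sin t) s)))).
    eapply is_derive_val; [exact E1|].
    unfold K, dK, dF, one, zero, opp, on_circle, a, b, c, e; simpl. ring.
  - unfold dK, dF. circle_cont.
  - apply continuity_2d_pt_slice. unfold K, dF. circle_cont. }
assert (K0 : forall s, 0 <= s < d -> RInt (K s) 0 (2 * PI) = 0).
{ intros s Hs. rewrite (eq_of_derive_0 _ _ d HK); [| |exact Hs].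
  - apply RInt_zero. intros t. unfold K. ring.
  - clear s Hs. intros s Hs.
    (* dK is the angular derivative of Im (phi e^{it}). *)
    apply (RInt_exact (fun t => on_circle a x y s t * sin t + on_circle b x y s t * cos t) _ 1);
      [lra|lra| | |].
    + rewrite !on_circle_periodic, cos_2PI, sin_2PI, cos_0, sin_0. easy.
    + intros t _;
      destruct (harmonic_at_facts _ _ _ _ _ (H _ _ (circle_in_disc x y d s t ltac:(lra))))
        as [[Dh [Da Db]] [Kh [Ka [Kb [Kc Ke]]]]].
      assert (D1 := is_derive_on_circle_t _ _ _ _ _ _ _ Da).
      assert (D2 := is_derive_on_circle_t _ _ _ _ _ _ _ Db).
      assert (E1 := is_derive_Rplus _ _ _ _ _
        (is_derive_Rmult _ _ _ _ _ D1 (is_derive_sin t))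
        (is_derive_Rmult _ _ _ _ _ D2 (is_derive_cos t))).
      eapply is_derive_val; [exact E1|].
      unfold dK, dF, on_circle, a, b, c, e; simpl. ring.
    + intros t _;
      destruct (harmonic_at_facts _ _ _ _ _ (H _ _ (circle_in_disc x y d s t ltac:(lra))))
        as [[Dh [Da Db]] [Kh [Ka [Kb [Kc Ke]]]]].
      apply continuity_2d_pt_slice. unfold dK, dF. circle_cont. }
assert (HF : forall r, - d < r < d ->
  is_derive (fun r => RInt (on_circle h x y r) 0 (2 * PI)) r (RInt (dF r) 0 (2 * PI))).
{ apply (is_derive_RInt_open _ _ _ _ (- 1) _ _ (2 * PI + 1)); try lra.
  intros s t Hs _.
  destruct (harmonic_at_facts _ _ _ _ _ (H _ _ (circle_in_disc x y d s t Hs)))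
    as [[Dh [Da Db]] [Kh [Ka [Kb [Kc Ke]]]]].
  split; [|split].
  - apply is_derive_on_circle_r. exact Dh.
  - unfold dF. circle_cont.
  - apply continuity_2d_pt_slice. circle_cont. }
rewrite (eq_of_derive_0 _ _ d HF).
- rewrite <- circle_mean_const. apply RInt_ext. intros t _.
  unfold on_circle. rewrite !Rmult_0_l, !Rplus_0_r. easy.
- intros s Hs.
  assert (Hk := K0 s ltac:(lra)). unfold K in Hk.
  rewrite (RInt_scal (V := R_CompleteNormedModule)) in Hk.
  + unfold scal in Hk; simpl in Hk; unfold mult in Hk; simpl in Hk.
    apply Rmult_integral in Hk. destruct Hk as [Hk|Hk]; [lra|exact Hk].
  + apply continuity_2d_ex_RInt. intros t.
    destruct (harmonic_at_facts _ _ _ _ _ (H _ _ (circle_in_disc x y d s t ltac:(lra))))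
      as [[Dh [Da Db]] [Kh [Ka [Kb [Kc Ke]]]]].
    unfold dF. circle_cont.
- exact Hr.
Qed.

(** Let M(r) be the integral of h sin t.  Integrating by parts in t,
    (r M)' = - r times the integral of Im phi, which is -2 PI r Im phi(x, y) by
    [mean_Im_gradient]. *)
Lemma first_sine_coefficient (h : R -> R -> R) (phi dphi : C -> C) (x y d r : R) :
  (forall u v, (u - x) ^ 2 + (v - y) ^ 2 < d ^ 2 -> harmonic_at h phi dphi u v) ->
  0 < r < d ->
  RInt (fun t => on_circle h x y r t * sin t) 0 (2 * PI) = - (PI * r * Im (phi (x, y))).
Proof.
intros H Hr. assert (Hpi := two_PI_pos).
set (a := fun u v => Re (phi (u, v))). set (b := fun u v => Im (phi (u, v))).
set (I0 := Im (phi (x, y))).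
set (f := fun r t => r * (on_circle h x y r t * sin t)).
set (df := fun r t => on_circle h x y r t * sin t
   + r * ((on_circle a x y r t * cos t + - on_circle b x y r t * sin t) * sin t)).
assert (HF : forall r, - d < r < d ->
  is_derive (fun r => RInt (f r) 0 (2 * PI) + PI * r ^ 2 * I0) r
    (RInt (df r) 0 (2 * PI) + 2 * PI * r * I0)).
{ intros s Hs. apply (is_derive_Rplus).
  2:{ auto_derive; [easy|ring]. }
  revert s Hs.
  apply (is_derive_RInt_open _ _ _ _ (- 1) _ _ (2 * PI + 1)); try lra.
  intros s t Hs _.
  destruct (harmonic_at_facts _ _ _ _ _ (H _ _ (circle_in_disc x y d s t Hs)))
    as [[Dh [Da Db]] [Kh [Ka [Kb [Kc Ke]]]]].
  assert (D1 := is_derive_on_circle_r _ _ _ _ _ _ _ Dh).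
  split; [|split].
  - assert (E1 := is_derive_Rmult _ _ _ _ _ (is_derive_id s)
      (is_derive_Rmult _ _ _ _ _ D1 (is_derive_const (sin t) s))).
    eapply is_derive_val; [exact E1|].
    unfold df, one, zero, on_circle, a, b; simpl. ring.
  - unfold df. circle_cont.
  - apply continuity_2d_pt_slice. unfold f. circle_cont. }
assert (Hz : RInt (f r) 0 (2 * PI) + PI * r ^ 2 * I0 = 0).
{ rewrite (eq_of_derive_0 _ _ d HF); [| |lra].
  - rewrite RInt_zero; [ring|]. intros t. unfold f. ring.
  - intros s Hs.
    assert (Hb := mean_Im_gradient h phi dphi x y d s H ltac:(lra)).
    fold b I0 in Hb.
    assert (Cb : ex_RInt (on_circle b x y s) 0 (2 * PI)).
    { apply continuity_2d_ex_RInt. intros t.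
      destruct (harmonic_at_facts _ _ _ _ _ (H _ _ (circle_in_disc x y d s t ltac:(lra))))
        as [[Dh [Da Db]] [Kh [Ka [Kb [Kc Ke]]]]]. circle_cont. }
    assert (Cd : ex_RInt (df s) 0 (2 * PI)).
    { apply continuity_2d_ex_RInt. intros t.
      destruct (harmonic_at_facts _ _ _ _ _ (H _ _ (circle_in_disc x y d s t ltac:(lra))))
        as [[Dh [Da Db]] [Kh [Ka [Kb [Kc Ke]]]]]. unfold df. circle_cont. }
    assert (E : RInt (fun t => plus (df s t) (scal s (on_circle b x y s t))) 0 (2 * PI) = 0).
    { apply (RInt_exact (fun t => - (on_circle h x y s t * cos t)) _ 1); [lra|lra| | |].
      - rewrite !on_circle_periodic, cos_2PI, cos_0. easy.
      - intros t _.
        destruct (harmonic_at_facts _ _ _ _ _ (H _ _ (circle_in_disc x y d s t ltac:(lra))))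
          as [[Dh [Da Db]] [Kh [Ka [Kb [Kc Ke]]]]].
        assert (D1 := is_derive_on_circle_t _ _ _ _ _ _ _ Dh).
        assert (E1 := is_derive_opp _ _ _ (is_derive_Rmult _ _ _ _ _ D1 (is_derive_cos t))).
        eapply is_derive_val; [exact E1|].
        assert (S := sin2_cos2 t). unfold Rsqr in S.
        unfold plus, scal, opp; simpl; unfold mult; simpl.
        unfold df, on_circle; fold a b.
        set (bb := Im (phi (x + s * cos t, y + s * sin t))).
        change (b (x + s * cos t) (y + s * sin t)) with bb.
        change (Re (phi (x + s * cos t, y + s * sin t))) with (a (x + s * cos t) (y + s * sin t)).
        replace (s * bb) with (s * bb * (sin t * sin t + cos t * cos t)) by (rewrite S; ring).
        ring.
      - intros t _.
        destruct (harmonic_at_facts _ _ _ _ _ (H _ _ (circle_in_disc x y d s t ltac:(lra))))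
          as [[Dh [Da Db]] [Kh [Ka [Kb [Kc Ke]]]]].
        apply (continuity_2d_pt_slice (fun s t => plus (df s t) (scal s (on_circle b x y s t)))).
        unfold plus, scal; simpl; unfold mult; simpl. unfold df. circle_cont. }
    rewrite (RInt_plus (V := R_CompleteNormedModule)) in E; [|exact Cd|].
    2:{ apply (ex_RInt_scal (V := R_CompleteNormedModule)). exact Cb. }
    rewrite (RInt_scal (V := R_CompleteNormedModule)), Hb in E by exact Cb.
    unfold plus, scal in E; simpl in E; unfold mult in E; simpl in E.
    etransitivity; [|exact E]. ring. }
unfold f in Hz.
rewrite (RInt_scal (V := R_CompleteNormedModule)) in Hz.
- unfold scal in Hz; simpl in Hz; unfold mult in Hz; simpl in Hz.
  apply Rmult_eq_reg_l with r; lra.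
- apply (continuity_2d_ex_RInt (fun r t => on_circle h x y r t * sin t)). intros t.
  destruct (harmonic_at_facts _ _ _ _ _ (H _ _ (circle_in_disc x y d r t ltac:(lra))))
    as [[Dh [Da Db]] [Kh [Ka [Kb [Kc Ke]]]]]. circle_cont.
Qed.

(** * Harnack's inequality along a segment *)

Lemma Rabs_lt_of_sqr (x y d : R) :
  0 < d -> x ^ 2 + y ^ 2 < d ^ 2 -> Rabs x < d /\ Rabs y < d.
Proof.
intros Hd H. rewrite <- (pow2_abs x), <- (pow2_abs y) in H.
generalize (Rabs_pos x) (Rabs_pos y); intros.
split; apply Rnot_le_lt; intros Hle; nra.
Qed.

(** As M - h >= 0 and 1 + sg sin t >= 0 for |sg| <= 1, the integral of
    (M - h) (1 + sg sin t) over the circle is nonnegative; it is evaluated by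
    [mean_value] and [first_sine_coefficient]. *)
Lemma gradient_bound (h : R -> R -> R) (phi dphi : C -> C) (x y d r M : R) :
  (forall u v, (u - x) ^ 2 + (v - y) ^ 2 < d ^ 2 ->
     harmonic_at h phi dphi u v /\ h u v <= M) ->
  0 < r < d ->
  r * Rabs (Im (phi (x, y))) <= 2 * (M - h x y).
Proof.
intros H Hr. assert (Hpi := two_PI_pos).
assert (Hg : forall u v, (u - x) ^ 2 + (v - y) ^ 2 < d ^ 2 -> harmonic_at h phi dphi u v)
  by (intros; apply H; easy).
assert (H1 := mean_value h phi dphi x y d r Hg ltac:(lra)).
assert (H2 := first_sine_coefficient h phi dphi x y d r Hg Hr).
set (f := on_circle h x y r) in *.
assert (Hc : forall t, continuity_2d_pt (on_circle h x y) r t).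
{ intros t.
  destruct (harmonic_at_facts _ _ _ _ _ (Hg _ _ (circle_in_disc x y d r t ltac:(lra))))
    as [_ [Kh _]]. circle_cont. }
assert (E1 : is_RInt f 0 (2 * PI) (2 * PI * h x y)).
{ rewrite <- H1. apply (RInt_correct (V := R_CompleteNormedModule)).
  apply continuity_2d_ex_RInt, Hc. }
assert (E2 : is_RInt (fun t => f t * sin t) 0 (2 * PI) (- (PI * r * Im (phi (x, y))))).
{ rewrite <- H2. apply (RInt_correct (V := R_CompleteNormedModule)).
  apply (continuity_2d_ex_RInt (fun r t => on_circle h x y r t * sin t)). intros t.
  apply continuity_2d_pt_mult; [apply Hc|apply continuity_2d_sin]. }
assert (E3 : is_RInt sin 0 (2 * PI) 0).
{ replace 0 with (minus (- cos (2 * PI)) (- cos 0)) at 2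
    by (rewrite cos_2PI, cos_0; unfold minus, plus, opp; simpl; ring).
  apply (is_RInt_derive (V := R_CompleteNormedModule) (fun t => - cos t)).
  - intros t _. auto_derive; [easy|ring].
  - intros t _. apply continuity_pt_filterlim, continuity_sin. }
assert (E4 : forall sg, - 1 <= sg <= 1 ->
  0 <= 2 * PI * M - 2 * PI * h x y + sg * (PI * r * Im (phi (x, y)))).
{ intros sg Hsg.
  assert (E := is_RInt_plus _ _ _ _ _ _
    (is_RInt_minus _ _ _ _ _ _ (is_RInt_const 0 (2 * PI) M) E1)
    (is_RInt_plus _ _ _ _ _ _ (is_RInt_scal _ _ _ (sg * M) _ E3)
       (is_RInt_scal _ _ _ (- sg) _ E2))).
  refine (Rle_trans _ _ _ (RInt_ge_0 _ 0 (2 * PI) _ (ex_intro _ _ E) _) _); [lra| |].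
  - intros t _.
    assert (Hm : h (x + r * cos t) (y + r * sin t) <= M)
      by (apply H, circle_in_disc; lra).
    assert (Hs := SIN_bound t).
    unfold f, on_circle, minus, plus, opp, scal; simpl; unfold mult; simpl.
    apply Rle_trans with ((M - h (x + r * cos t) (y + r * sin t)) * (1 + sg * sin t)).
    + apply Rmult_le_pos; [lra|]. nra.
    + apply Req_le. ring.
  - apply Req_le. rewrite (is_RInt_unique (V := R_CompleteNormedModule) _ _ _ _ E).
    unfold minus, plus, opp, scal; simpl; unfold mult; simpl. ring. }
assert (P1 := E4 1 ltac:(lra)). assert (P2 := E4 (- 1) ltac:(lra)).
assert (Hp : 0 < PI) by apply PI_RGT_0.
apply Rmult_le_reg_l with PI; [easy|].
unfold Rabs; destruct Rcase_abs; lra.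
Qed.

(** Gronwall's inequality in both directions of time. *)
Lemma exp_growth (u du : R -> R) (k a b : R) :
  (forall t, a <= t <= b -> is_derive u t (du t)) ->
  (forall t, a <= t <= b -> Rabs (du t) <= k * u t) ->
  forall t1 t2, a <= t1 <= b -> a <= t2 <= b ->
  u t2 <= exp (k * Rabs (t2 - t1)) * u t1.
Proof.
intros Hu Hd t1 t2 Ht1 Ht2.
destruct (Rtotal_order t1 t2) as [Hlt|[<-|Hlt]].
- rewrite Rabs_pos_eq by lra.
  destruct (MVT_cor2 (fun t => u t * exp (- k * t))
     (fun t => (du t - k * u t) * exp (- k * t)) t1 t2 Hlt) as [c [Hc Hc2]].
  { intros c Hc. apply is_derive_Reals. auto_derive.
    - exists (du c). apply Hu; lra.
    - replace (Derive (fun x => u x) c) with (du c)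
        by (symmetry; apply is_derive_unique, Hu; lra). ring. }
  assert (Hk := Hd c ltac:(lra)). apply Rabs_le_between in Hk.
  assert (Hm : u t2 * exp (- k * t2) <= u t1 * exp (- k * t1)).
  { apply Rminus_le. rewrite Hc.
    assert (He := exp_pos (- k * c)).
    assert (0 <= (k * u c - du c) * exp (- k * c) * (t2 - t1)); [|nra].
    repeat apply Rmult_le_pos; lra. }
  apply Rmult_le_reg_r with (exp (- k * t2)); [apply exp_pos|].
  eapply Rle_trans; [exact Hm|]. apply Req_le.
  rewrite (Rmult_comm _ (u t1)), Rmult_assoc, <- exp_plus. f_equal. f_equal. ring.
- rewrite Rminus_diag, Rabs_R0, Rmult_0_r, exp_0. lra.
- rewrite Rabs_left by lra.
  destruct (MVT_cor2 (fun t => u t * exp (k * t))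
     (fun t => (du t + k * u t) * exp (k * t)) t2 t1 Hlt) as [c [Hc Hc2]].
  { intros c Hc. apply is_derive_Reals. auto_derive.
    - exists (du c). apply Hu; lra.
    - replace (Derive (fun x => u x) c) with (du c)
        by (symmetry; apply is_derive_unique, Hu; lra). ring. }
  assert (Hk := Hd c ltac:(lra)). apply Rabs_le_between in Hk.
  assert (Hm : u t2 * exp (k * t2) <= u t1 * exp (k * t1)).
  { apply Rminus_le.
    assert (He := exp_pos (k * c)).
    assert (0 <= (k * u c + du c) * exp (k * c) * (t1 - t2)); [|nra].
    repeat apply Rmult_le_pos; lra. }
  apply Rmult_le_reg_r with (exp (k * t2)); [apply exp_pos|].
  eapply Rle_trans; [exact Hm|]. apply Req_le.
  rewrite (Rmult_comm _ (u t1)), Rmult_assoc, <- exp_plus. f_equal. f_equal. ring.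
Qed.

(** Discs of radius d around the points of the segment lie in the box, so
    [gradient_bound] with r = d / 2 gives a logarithmic derivative of at most
    4 / d, over a length of at most 2 w. *)
Lemma harnack_vertical (h : R -> R -> R) (phi dphi : C -> C) (M s w d : R) :
  0 < d ->
  (forall x y, Rabs (x - s) < d -> Rabs y < w + d ->
     harmonic_at h phi dphi x y /\ h x y <= M) ->
  forall t1 t2, Rabs t1 <= w -> Rabs t2 <= w ->
  M - h s t2 <= exp (8 * w / d) * (M - h s t1).
Proof.
intros Hd H t1 t2 Ht1 Ht2.
assert (Hp : forall t, Rabs t <= w -> harmonic_at h phi dphi s t /\ h s t <= M).
{ intros t Ht. apply H; [rewrite Rminus_diag, Rabs_R0; easy|lra]. }
assert (Hgr : M - h s t2 <= exp (4 / d * Rabs (t2 - t1)) * (M - h s t1)).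
{ apply (exp_growth (fun t => M - h s t) (fun t => Im (phi (s, t))) (4 / d) (- w) w).
  - intros t Ht.
    destruct (Hp t ltac:(apply Rabs_le; lra)) as [[Hdif _] _].
    assert (D1 : is_derive (fun t => h s t) t (- Im (phi (s, t)))).
    { exact (is_derive_slice2 _ _ _ _ _ Hdif). }
    auto_derive; [eexists; exact D1|].
    replace (Derive (fun x => h s x) t) with (- Im (phi (s, t)))
      by (symmetry; apply is_derive_unique, D1). ring.
  - intros t Ht.
    assert (G := gradient_bound h phi dphi s t d (d / 2) M).
    apply Rmult_le_reg_l with (d / 2); [lra|].
    replace (d / 2 * (4 / d * (M - h s t))) with (2 * (M - h s t)) by (field; lra).
    apply G; [|lra]. intros u v Huv.
    destruct (Rabs_lt_of_sqr _ _ _ Hd Huv) as [H1 H2].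
    apply H; [easy|]. apply Rabs_def2 in H2. apply Rabs_def1; lra.
  - apply Rabs_le_between in Ht1; lra.
  - apply Rabs_le_between in Ht2; lra. }
eapply Rle_trans; [exact Hgr|]. apply Rmult_le_compat_r.
- destruct (Hp t1 Ht1) as [_ G]; lra.
- replace (8 * w / d) with (4 / d * (2 * w)) by (field; lra).
  assert (0 < 4 / d) by (apply Rdiv_lt_0_compat; lra).
  assert (Rabs (t2 - t1) <= 2 * w).
  { apply Rabs_le_between in Ht1; apply Rabs_le_between in Ht2; apply Rabs_le; lra. }
  assert (Hle : 4 / d * Rabs (t2 - t1) <= 4 / d * (2 * w)) by (apply Rmult_le_compat_l; lra).
  destruct Hle as [Hle| ->]; [left; apply exp_increasing, Hle|right; easy].
Qed.

(** * Growth of positive harmonic functions along a strip *)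

(** With y(s) = 2 sinh (a (s - alpha)), a solution of y'' = a^2 y vanishing at
    alpha, the Wronskian N = F' y - F y' decreases and N(alpha) <= 0; hence F / y
    decreases. *)
Lemma sinh_comparison (F dF ddF : R -> R) (a x1 x2 alpha : R) :
  0 < a ->
  (forall s, x1 < s < x2 -> is_derive F s (dF s) /\ is_derive dF s (ddF s) /\
     0 <= F s /\ ddF s <= a ^ 2 * F s) ->
  x1 < alpha ->
  forall s1 s2, alpha < s1 -> s1 <= s2 -> s2 < x2 ->
  F s2 * (exp (a * (s1 - alpha)) - exp (- (a * (s1 - alpha)))) <=
  F s1 * (exp (a * (s2 - alpha)) - exp (- (a * (s2 - alpha)))).
Proof.
intros Ha H Hal s1 s2 H1 H12 H2.
set (y := fun s => exp (a * (s - alpha)) - exp (- (a * (s - alpha)))).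
set (dy := fun s => a * (exp (a * (s - alpha)) + exp (- (a * (s - alpha))))).
assert (Dy : forall s, is_derive y s (dy s)).
{ intros s. unfold y, dy, Rminus. auto_derive; [easy|ring]. }
assert (Ddy : forall s, is_derive dy s (a ^ 2 * y s)).
{ intros s. unfold y, dy, Rminus. auto_derive; [easy|ring]. }
assert (Hy : forall s, alpha < s -> 0 < y s).
{ intros s Hs. unfold y. apply Rlt_0_minus, exp_increasing.
  assert (0 < a * (s - alpha)) by (apply Rmult_lt_0_compat; lra). lra. }
set (N := fun s => dF s * y s - F s * dy s).
assert (DN : forall s, x1 < s < x2 -> is_derive N s ((ddF s - a ^ 2 * F s) * y s)).
{ intros s Hs. destruct (H s Hs) as [D1 [D2 _]].
  assert (E := is_derive_minus _ _ _ _ _ (is_derive_Rmult _ _ _ _ _ D2 (Dy s))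
                 (is_derive_Rmult _ _ _ _ _ D1 (Ddy s))).
  eapply is_derive_val; [exact E|].
  unfold minus, plus, opp; simpl. ring. }
assert (HN : forall s, alpha <= s < x2 -> N s <= 0).
{ intros s Hs. apply Rle_trans with (N alpha).
  - destruct (proj1 Hs) as [Hlt|<-]; [|lra].
    destruct (MVT_cor2 N (fun s => (ddF s - a ^ 2 * F s) * y s) alpha s Hlt) as [c [Hc Hc2]].
    { intros c Hc. apply is_derive_Reals, DN; lra. }
    destruct (H c ltac:(lra)) as [_ [_ [_ Hle]]].
    assert (0 <= (a ^ 2 * F c - ddF c) * y c * (s - alpha)).
    { assert (Hyc := Hy c ltac:(lra)). repeat apply Rmult_le_pos; lra. }
    nra.
  - unfold N, y, dy. rewrite Rminus_diag, Rmult_0_r, Ropp_0, exp_0.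
    destruct (H alpha ltac:(lra)) as [_ [_ [HF _]]]. nra. }
destruct H12 as [H12|<-]; [|lra].
destruct (MVT_cor2 (fun s => F s / y s) (fun s => N s / (y s) ^ 2) s1 s2 H12) as [c [Hc Hc2]].
{ intros c Hc. apply is_derive_Reals.
  destruct (H c ltac:(lra)) as [D1 _].
  assert (Hyc := Hy c ltac:(lra)).
  apply (is_derive_div F y c (dF c) (dy c) D1 (Dy c)). lra. }
assert (Hyc := Hy c ltac:(lra)).
assert (HNc := HN c ltac:(lra)).
assert (Hle : F s2 / y s2 <= F s1 / y s1).
{ apply Rminus_le. rewrite Hc.
  assert (0 <= (- N c) * / (y c) ^ 2 * (s2 - s1)).
  { repeat apply Rmult_le_pos; try lra. left. apply Rinv_0_lt_compat, pow_lt, Hyc. }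
  unfold Rdiv. nra. }
assert (Hy1 := Hy s1 ltac:(lra)). assert (Hy2 := Hy s2 ltac:(lra)).
apply Rmult_le_compat_r with (r := y s1 * y s2) in Hle; [|apply Rmult_le_pos; lra].
replace (F s2 / y s2 * (y s1 * y s2)) with (F s2 * y s1) in Hle by (field; lra).
replace (F s1 / y s1 * (y s1 * y s2)) with (F s1 * y s2) in Hle by (field; lra).
exact Hle.
Qed.

Definition cosine_moment (u : R -> R -> R) (a w s : R) : R :=
  RInt (fun t => u s t * cos (a * t)) (- w) w.

Lemma continuity_2d_cos_scaled (a s t : R) :
  continuity_2d_pt (fun _ v => cos (a * v)) s t.
Proof.
apply (continuity_1d_2d_pt_comp cos (fun _ v => a * v)).
- apply continuity_cos.
- apply continuity_2d_pt_mult; [apply continuity_2d_pt_const|apply continuity_2d_pt_id2].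
Qed.

(** Integrating by parts twice in t and using h_ss = - h_tt moves the derivatives
    onto cos (a t).  The cosine vanishes at the ends t = w and t = - w, so the
    only boundary term is - a (u(s, w) + u(s, - w)) <= 0, where u = M - h. *)
Lemma cosine_moment_ode (h : R -> R -> R) (phi dphi : C -> C) (M a w d x1 x2 : R) :
  0 < a -> a * w = PI / 2 -> 0 < d ->
  (forall s t, x1 < s < x2 -> - w - d < t < w + d ->
     harmonic_at h phi dphi s t /\ h s t <= M) ->
  let F := cosine_moment (fun s t => M - h s t) a w in
  exists dF ddF : R -> R, forall s, x1 < s < x2 ->
    is_derive F s (dF s) /\ is_derive dF s (ddF s) /\
    0 <= F s /\ ddF s <= a ^ 2 * F s.
Proof.
intros Ha Haw Hd H F. assert (Hpi := PI_RGT_0).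
assert (Hw : 0 < w).
{ apply Rmult_lt_reg_l with a; [easy|]. lra. }
set (ra := fun s t => Re (phi (s, t))). set (b := fun s t => Im (phi (s, t))).
set (c := fun s t => Re (dphi (s, t))).
set (u := fun s t => M - h s t).
exists (fun s => RInt (fun t => - ra s t * cos (a * t)) (- w) w).
exists (fun s => RInt (fun t => - c s t * cos (a * t)) (- w) w).
intros s Hs.
assert (Cu : forall t, - w - d < t < w + d ->
   continuity_2d_pt (fun s t => u s t * cos (a * t)) s t).
{ intros t Ht. destruct (H s t Hs Ht) as [Hg _].
  destruct (harmonic_at_facts _ _ _ _ _ Hg) as [_ [Kh _]].
  apply continuity_2d_pt_mult; [|apply continuity_2d_cos_scaled].
  unfold u. circle_cont. }
assert (Cc : forall t, - w - d < t < w + d ->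
   continuity_2d_pt (fun s t => - c s t * cos (a * t)) s t).
{ intros t Ht. destruct (H s t Hs Ht) as [Hg _].
  destruct (harmonic_at_facts _ _ _ _ _ Hg) as [_ [_ [_ [_ [Kc _]]]]].
  apply continuity_2d_pt_mult; [|apply continuity_2d_cos_scaled].
  circle_cont. }
assert (Iu : ex_RInt (fun t => u s t * cos (a * t)) (- w) w).
{ apply (ex_RInt_continuous (V := R_CompleteNormedModule)).
  rewrite Rmin_left, Rmax_right by lra. intros t Ht.
  apply (continuity_2d_pt_slice (fun s t => u s t * cos (a * t))). apply Cu; lra. }
assert (Ic : ex_RInt (fun t => - c s t * cos (a * t)) (- w) w).
{ apply (ex_RInt_continuous (V := R_CompleteNormedModule)).
  rewrite Rmin_left, Rmax_right by lra. intros t Ht.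
  apply (continuity_2d_pt_slice (fun s t => - c s t * cos (a * t))). apply Cc; lra. }
split; [|split; [|split]].
- clear Cu Cc Iu Ic. revert s Hs.
  apply (is_derive_RInt_open (fun s t => (M - h s t) * cos (a * t))
    (fun s t => - ra s t * cos (a * t)) x1 x2 (- w - d) (- w) w (w + d)); try lra.
  intros s t Hs Ht. destruct (H s t Hs Ht) as [Hg _].
  destruct (harmonic_at_facts _ _ _ _ _ Hg) as [[Dh _] [Kh [Ka _]]].
  split; [|split].
  + apply is_derive_slice1 in Dh.
    assert (E1 := is_derive_Rmult _ _ _ _ _ (is_derive_minus _ _ _ _ _
      (is_derive_const M s) Dh) (is_derive_const (cos (a * t)) s)).
    eapply is_derive_val; [exact E1|].
    unfold minus, plus, opp, zero, ra; simpl. ring.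
  + apply continuity_2d_pt_mult; [|apply continuity_2d_cos_scaled]. circle_cont.
  + apply (continuity_2d_pt_slice (fun s t => (M - h s t) * cos (a * t))).
    apply continuity_2d_pt_mult; [|apply continuity_2d_cos_scaled]. circle_cont.
- clear Cu Cc Iu Ic. revert s Hs.
  apply (is_derive_RInt_open (fun s t => - ra s t * cos (a * t))
    (fun s t => - c s t * cos (a * t)) x1 x2 (- w - d) (- w) w (w + d)); try lra.
  intros s t Hs Ht. destruct (H s t Hs Ht) as [Hg _].
  destruct (harmonic_at_facts _ _ _ _ _ Hg) as [[_ [Da _]] [_ [Ka [_ [Kc _]]]]].
  split; [|split].
  + apply is_derive_slice1 in Da.
    assert (E1 := is_derive_Rmult _ _ _ _ _ (is_derive_opp _ _ _ Da)
      (is_derive_const (cos (a * t)) s)).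
    eapply is_derive_val; [exact E1|].
    unfold minus, plus, opp, zero, c; simpl. ring.
  + apply continuity_2d_pt_mult; [|apply continuity_2d_cos_scaled]. circle_cont.
  + apply (continuity_2d_pt_slice (fun s t => - ra s t * cos (a * t))).
    apply continuity_2d_pt_mult; [|apply continuity_2d_cos_scaled]. circle_cont.
- apply RInt_ge_0; [lra|exact Iu|]. intros t Ht.
  destruct (H s t Hs ltac:(lra)) as [_ Hm].
  apply Rmult_le_pos; [lra|]. apply cos_ge_0; nra.
-
  (* P is an antiderivative of the integrand of ddF - a^2 F. *)
  set (P := fun t => - b s t * cos (a * t) - a * (u s t * sin (a * t))).
  set (p := fun t => - c s t * cos (a * t) - a ^ 2 * (u s t * cos (a * t))).
  assert (E : is_RInt p (- w) w (minus (P w) (P (- w)))).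
  { apply (is_RInt_derive (V := R_CompleteNormedModule));
      rewrite Rmin_left, Rmax_right by lra; intros t Ht;
      destruct (H s t Hs ltac:(lra)) as [Hg _];
      destruct (harmonic_at_facts _ _ _ _ _ Hg) as [[Dh [_ Db]] [Kh [_ [_ [Kc _]]]]].
    - apply is_derive_slice2 in Dh. apply is_derive_slice2 in Db.
      assert (Ecos : is_derive (fun t => cos (a * t)) t (- a * sin (a * t)))
        by (auto_derive; [easy|ring]).
      assert (Esin : is_derive (fun t => sin (a * t)) t (a * cos (a * t)))
        by (auto_derive; [easy|ring]).
      assert (E1 := is_derive_minus _ _ _ _ _
        (is_derive_Rmult _ _ _ _ _ (is_derive_opp _ _ _ Db) Ecos)
        (is_derive_Rmult _ _ _ _ _ (is_derive_const a t)
           (is_derive_Rmult _ _ _ _ _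
              (is_derive_minus _ _ _ _ _ (is_derive_const M t) Dh) Esin))).
      eapply is_derive_val; [exact E1|].
      unfold p, u, c, minus, plus, opp, zero; simpl. ring.
    - apply (continuity_2d_pt_slice
        (fun s t => - c s t * cos (a * t) - a ^ 2 * (u s t * cos (a * t)))).
      apply continuity_2d_pt_minus; [apply Cc; lra|].
      apply continuity_2d_pt_mult; [apply continuity_2d_pt_const|apply Cu; lra]. }
  assert (E' := RInt_minus (V := R_CompleteNormedModule) _ _ _ _ Ic
     (ex_RInt_scal (V := R_CompleteNormedModule) _ _ _ (a ^ 2) Iu)).
  rewrite (RInt_scal (V := R_CompleteNormedModule)) in E' by exact Iu.
  apply (is_RInt_unique (V := R_CompleteNormedModule)) in E.
  change (RInt p (- w) w = minus (RInt (fun t => - c s t * cos (a * t)) (- w) w)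
    (scal (a ^ 2) (F s))) in E'.
  rewrite E in E'.
  unfold minus, plus, opp, scal in E'; simpl in E'; unfold mult in E'; simpl in E'.
  unfold P in E'. rewrite <- Ropp_mult_distr_r, cos_neg, sin_neg, Haw, cos_PI2, sin_PI2 in E'.
  destruct (H s w Hs ltac:(lra)) as [_ M1].
  destruct (H s (- w) Hs ltac:(lra)) as [_ M2].
  assert (0 <= a * (u s w + u s (- w))) by (apply Rmult_le_pos; unfold u; lra).
  simpl. lra.
Qed.

(** The comparison function starts one unit to the left of s0, which gives the
    denominator.  Harnack's inequality on the cross-sections at s0 and s0 + T
    replaces the moments by values on the axis and gives the squared exponential.
    It matters that the factor in front of exp (a T) does not depend on T. *)
Lemma window_growth (h : R -> R -> R) (phi dphi : C -> C) (M a w d s0 T : R) :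
  0 < a -> a * w = PI / 2 -> 0 < d <= 1 -> 0 <= T ->
  (forall s t, s0 - 2 < s < s0 + T + 2 -> Rabs t < w + d ->
     harmonic_at h phi dphi s t /\ h s t <= M) ->
  M - h (s0 + T) 0 <=
    exp (8 * w / d) ^ 2 / (1 - exp (- (2 * a))) * exp (a * T) * (M - h s0 0).
Proof.
intros Ha Haw Hd HT H. assert (Hpi := PI_RGT_0).
assert (Hw : 0 < w).
{ apply Rmult_lt_reg_l with a; [easy|]. lra. }
assert (H' : forall s t, s0 - 2 < s < s0 + T + 2 -> - w - d < t < w + d ->
     harmonic_at h phi dphi s t /\ h s t <= M).
{ intros s t Hs Ht. apply H; [easy|]. apply Rabs_def1; lra. }
destruct (cosine_moment_ode h phi dphi M a w d _ _ Ha Haw (proj1 Hd) H') as [dF [ddF HF]].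
set (F := cosine_moment (fun s t => M - h s t) a w) in HF.
assert (G := sinh_comparison F dF ddF a (s0 - 2) (s0 + T + 2) (s0 - 1) Ha HF
  ltac:(lra) s0 (s0 + T) ltac:(lra) ltac:(lra) ltac:(lra)).
replace (a * (s0 - (s0 - 1))) with a in G by ring.
replace (a * (s0 + T - (s0 - 1))) with (a + a * T) in G by ring.
set (J := RInt (fun t => cos (a * t)) (- w) w).
assert (Ccos : forall t, continuous (fun t => cos (a * t)) t).
{ intros t. apply (continuity_2d_pt_slice (fun _ v => cos (a * v)) 0).
  apply continuity_2d_cos_scaled. }
assert (IJ : ex_RInt (fun t => cos (a * t)) (- w) w)
  by (apply (ex_RInt_continuous (V := R_CompleteNormedModule)); intros; apply Ccos).
assert (HJ : 0 < J).
{ apply RInt_gt_0; [lra| |intros; apply Ccos].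
  intros t Ht. apply cos_gt_0; nra. }
set (E := exp (8 * w / d)).
assert (HE : 0 < E) by apply exp_pos.
assert (HE0 : E <> 0) by lra.
assert (Har : forall s, s0 - 1 <= s <= s0 + T + 1 -> forall t1 t2, Rabs t1 <= w -> Rabs t2 <= w ->
   M - h s t2 <= E * (M - h s t1)).
{ intros s Hs. apply (harnack_vertical h phi dphi); [easy|].
  intros x y Hx Hy. apply H; [|easy]. apply Rabs_def2 in Hx. lra. }
assert (Iu : forall s, s0 - 2 < s < s0 + T + 2 -> ex_RInt (fun t => (M - h s t) * cos (a * t)) (- w) w).
{ intros s Hs. apply (ex_RInt_continuous (V := R_CompleteNormedModule)).
  rewrite Rmin_left, Rmax_right by lra. intros t Ht.
  apply (continuity_2d_pt_slice (fun s t => (M - h s t) * cos (a * t))).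
  destruct (H' s t Hs ltac:(lra)) as [Hg _].
  destruct (harmonic_at_facts _ _ _ _ _ Hg) as [_ [Kh _]].
  apply continuity_2d_pt_mult; [|apply continuity_2d_cos_scaled]. circle_cont. }
assert (R0 : Rabs 0 <= w) by (rewrite Rabs_R0; lra).
assert (Hup : F s0 <= E * (M - h s0 0) * J).
{ unfold J. rewrite <- (RInt_scal (V := R_CompleteNormedModule)) by exact IJ.
  apply RInt_le; [lra|apply Iu; lra| |].
  - apply (ex_RInt_scal (V := R_CompleteNormedModule)). exact IJ.
  - intros t Ht. unfold scal; simpl; unfold mult; simpl.
    apply Rmult_le_compat_r; [apply cos_ge_0; nra|].
    apply Har; [lra|easy|]. apply Rabs_le; lra. }
assert (Hlow : (M - h (s0 + T) 0) / E * J <= F (s0 + T)).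
{ unfold J. rewrite <- (RInt_scal (V := R_CompleteNormedModule)) by exact IJ.
  apply RInt_le; [lra| |apply Iu; lra|].
  - apply (ex_RInt_scal (V := R_CompleteNormedModule)). exact IJ.
  - intros t Ht. unfold scal; simpl; unfold mult; simpl.
    apply Rmult_le_compat_r; [apply cos_ge_0; nra|].
    apply Rmult_le_reg_l with E; [easy|].
    replace (E * ((M - h (s0 + T) 0) / E)) with (M - h (s0 + T) 0) by (field; lra).
    apply Har; [lra| |easy]. apply Rabs_le; lra. }
set (v1 := M - h s0 0) in *. set (v2 := M - h (s0 + T) 0) in *.
assert (HF0 : 0 <= F s0) by (apply HF; lra).
assert (Hq : 0 < 1 - exp (- (2 * a))).
{ apply Rlt_0_minus. rewrite <- exp_0. apply exp_increasing. lra. }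
rewrite exp_plus in G.
assert (G2 : F (s0 + T) * (1 - exp (- (2 * a))) <= F s0 * exp (a * T)).
{ apply Rmult_le_reg_r with (exp a); [apply exp_pos|].
  replace (F (s0 + T) * (1 - exp (- (2 * a))) * exp a) with
    (F (s0 + T) * (exp a - exp (- a))).
  2:{ replace (- (2 * a)) with (- a + - a) by ring. rewrite exp_plus.
      assert (exp a * exp (- a) = 1) by (rewrite <- exp_plus, Rplus_opp_r; apply exp_0).
      replace (exp (- a)) with (exp (- a) * (exp a * exp (- a))) at 1 by (rewrite H0; ring).
      ring. }
  eapply Rle_trans; [exact G|].
  rewrite Rmult_assoc. apply Rmult_le_compat_l; [easy|].
  generalize (exp_pos (- (a + a * T))); lra. }
assert (G3 : v2 / E * J * (1 - exp (- (2 * a))) <= E * v1 * J * exp (a * T)).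
{ eapply Rle_trans; [apply Rmult_le_compat_r; [lra|exact Hlow]|].
  eapply Rle_trans; [exact G2|]. apply Rmult_le_compat_r; [left; apply exp_pos|exact Hup]. }
apply Rmult_le_reg_r with (J * (1 - exp (- (2 * a))) / E).
{ apply Rdiv_lt_0_compat; [|easy]. apply Rmult_lt_0_compat; easy. }
apply Rle_trans with (v2 / E * J * (1 - exp (- (2 * a)))); [apply Req_le; field; lra|].
eapply Rle_trans; [exact G3|]. apply Req_le. field. lra.
Qed.

(** * Slow variation of a proximate order in logarithmic coordinates *)

Lemma LimSup_infty_lt (f : R -> R) (L c : R) :
  LimSup_infty f = Finite L -> L < c -> exists M, forall t, M <= t -> f t < c.
Proof.
intros HL Hc. apply NNPP. intros Hn.
destruct (proj2_sig (Rbar_ex_glb (fun y : Rbar => exists M : R,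
    y = Lub_Rbar (fun v : R => exists t : R, M <= t /\ v = f t)))) as [_ Hg].
assert (Hle : Rbar_le c (LimSup_infty f)); [|rewrite HL in Hle; simpl in Hle; lra].
apply Hg. intros y [M ->].
apply not_ex_all_not with (n := M) in Hn.
apply not_all_ex_not in Hn. destruct Hn as [t Ht].
apply imply_to_and in Ht. destruct Ht as [Ht1 Ht2].
apply Rbar_le_trans with (f t); [simpl; lra|].
apply Lub_Rbar_correct. exists t; easy.
Qed.

Lemma LimInf_infty_gt (f : R -> R) (L c : R) :
  LimInf_infty f = Finite L -> c < L -> exists M, forall t, M <= t -> c < f t.
Proof.
intros HL Hc. apply NNPP. intros Hn.
destruct (proj2_sig (Rbar_ex_lub (fun y : Rbar => exists M : R,
    y = Glb_Rbar (fun v : R => exists t : R, M <= t /\ v = f t)))) as [_ Hg].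
assert (Hle : Rbar_le (LimInf_infty f) c); [|rewrite HL in Hle; simpl in Hle; lra].
apply Hg. intros y [M ->].
apply not_ex_all_not with (n := M) in Hn.
apply not_all_ex_not in Hn. destruct Hn as [t Ht].
apply imply_to_and in Ht. destruct Ht as [Ht1 Ht2].
apply Rbar_le_trans with (f t); [|simpl; lra].
apply Glb_Rbar_correct. exists t; easy.
Qed.

Lemma C1_from_is_derive (r0 t : R) (f df : R -> R) :
  C1_from r0 f df -> r0 < t -> is_derive f t (df t).
Proof.
intros [H _] Ht. apply is_derive_Reals. intros eps He.
assert (Hloc : locally (df t) (fun y => Rabs (y - df t) < eps)).
{ exists (mkposreal eps He). intros y Hy. exact Hy. }
destruct (H t (Rlt_le _ _ Ht) _ Hloc) as [delta Hd].
assert (Hm : 0 < Rmin delta (t - r0)) by (apply Rmin_pos; [apply cond_pos|lra]).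
exists (mkposreal _ Hm). simpl. intros k Hk0 Hk.
assert (Hk1 := Rlt_le_trans _ _ _ Hk (Rmin_l _ _)).
assert (Hk2 := Rlt_le_trans _ _ _ Hk (Rmin_r _ _)).
apply Rabs_def2 in Hk2.
replace k with (t + k - t) at 2 by ring.
apply Hd.
- change (Rabs (t + k - t) < delta). replace (t + k - t) with k by ring. exact Hk1.
- lra.
- lra.
Qed.

(** In terms of L s = l (exp s), the condition l'(t) t log t -> 0 reads
    s L'(s) -> 0. *)
Definition slowly_varying (L : R -> R) (m1 m2 : R) : Prop :=
  forall kappa, 0 < kappa -> exists (S : R) (dL : R -> R), 1 <= S /\
    forall s, S <= s -> is_derive L s (dL s) /\ m1 <= L s <= m2 /\
      s * Rabs (dL s) <= kappa.

Lemma proximate_order_slowly_varying (l : R -> R) (l1 l2 : R) :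
  generalized_proximate_order 1 l ->
  LimInf_infty l = Finite l1 -> LimSup_infty l = Finite l2 -> 0 < l1 ->
  slowly_varying (fun s => l (exp s)) (l1 / 2) (l2 + 1).
Proof.
intros [_ [_ [_ [_ [dl [HC Hdl]]]]]] H1 H2 Hl1 kappa Hk.
destruct (LimInf_infty_gt _ _ (l1 / 2) H1 ltac:(lra)) as [M1 HM1].
destruct (LimSup_infty_lt _ _ (l2 + 1) H2 ltac:(lra)) as [M2 HM2].
destruct (LimSup_infty_lt _ _ kappa Hdl Hk) as [M3 HM3].
exists (Rmax 1 (Rmax M1 (Rmax M2 M3))), (fun s => dl (exp s) * exp s).
split; [apply Rmax_l|].
intros s Hs.
assert (S0 := Rle_trans _ _ _ (Rmax_l _ _) Hs).
assert (S1 := Rle_trans _ _ _ (Rmax_r _ _) Hs).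
assert (S2 := Rle_trans _ _ _ (Rmax_r _ _) S1).
assert (S3 := Rle_trans _ _ _ (Rmax_r _ _) S2).
apply Rle_trans with (1 := Rmax_l _ _) in S1.
apply Rle_trans with (1 := Rmax_l _ _) in S2.
assert (He := exp_ineq1_le s).
split; [|split].
- apply is_derive_Reals.
  apply (derivable_pt_lim_comp exp l s (exp s) (dl (exp s))).
  + apply derivable_pt_lim_exp.
  + apply is_derive_Reals. apply (C1_from_is_derive 1); [exact HC|lra].
- split; left; [apply HM1|apply HM2]; lra.
- left. generalize (HM3 (exp s) ltac:(lra)). rewrite ln_exp.
  rewrite Rabs_mult, (Rabs_pos_eq (exp s)) by (left; apply exp_pos). lra.
Qed.

(** Besides L itself, P(s) = s L(s) is controlled, since P' = L + s L' is within
    kappa of L. *)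
Lemma slow_variation (L dL : R -> R) (m1 m2 kappa S : R) :
  1 <= S -> 0 <= m1 ->
  (forall s, S <= s -> is_derive L s (dL s) /\ m1 <= L s <= m2 /\
      s * Rabs (dL s) <= kappa) ->
  forall s s', S <= s -> S <= s' ->
  L s' <= L s + kappa * Rabs (s' - s) /\
  s' * L s' <= s * L s + (m2 + kappa) * Rabs (s' - s) /\
  (s <= s' -> s * L s + (L s - kappa * (s' - s) - kappa) * (s' - s) <= s' * L s').
Proof.
intros HS Hm1 H.
assert (HdL : forall s, S <= s -> Rabs (dL s) <= kappa).
{ intros s Hs. destruct (H s Hs) as [_ [_ Hk]]. generalize (Rabs_pos (dL s)); nra. }
assert (Hk : 0 <= kappa) by (eapply Rle_trans; [apply Rabs_pos|apply (HdL S); lra]).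
assert (A1 : forall s s', S <= s -> S <= s' -> Rabs (L s' - L s) <= kappa * Rabs (s' - s)).
{ intros s s' Hs Hs'.
  destruct (MVT_gen L s s' dL) as [c [Hc ->]].
  - intros x Hx. apply H. generalize (Rmin_glb s s' S Hs Hs'); lra.
  - intros x Hx. apply derivable_continuous_pt. exists (dL x).
    apply is_derive_Reals, H. generalize (Rmin_glb s s' S Hs Hs'); lra.
  - rewrite Rabs_mult. apply Rmult_le_compat_r; [apply Rabs_pos|].
    apply HdL. generalize (Rmin_glb s s' S Hs Hs'); lra. }
assert (DP : forall s, S <= s -> is_derive (fun s => s * L s) s (L s + s * dL s)).
{ intros s Hs. eapply is_derive_val.
  - apply (is_derive_Rmult (fun s => s) L s); [apply is_derive_id|apply H, Hs].
  - unfold one; simpl. ring. }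
assert (Hsd : forall s, S <= s -> - kappa <= s * dL s <= kappa).
{ intros s Hs. apply Rabs_le_between. rewrite Rabs_mult, (Rabs_pos_eq s) by lra.
  apply H, Hs. }
intros s s' Hs Hs'.
split; [|split].
- generalize (A1 s s' Hs Hs') (Rle_abs (L s' - L s)); lra.
- destruct (MVT_gen (fun s => s * L s) s s' (fun s => L s + s * dL s)) as [c [Hc He]].
  + intros x Hx. apply DP. generalize (Rmin_glb s s' S Hs Hs'); lra.
  + intros x Hx. apply derivable_continuous_pt. eexists.
    apply is_derive_Reals, DP. generalize (Rmin_glb s s' S Hs Hs'); lra.
  + assert (Hc' : S <= c) by (generalize (Rmin_glb s s' S Hs Hs'); lra).
    assert (Hb : Rabs (L c + c * dL c) <= m2 + kappa).
    { destruct (H c Hc') as [_ [Hm _]]. assert (Hd := Hsd c Hc').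
      apply Rabs_le. lra. }
    assert (Hle : Rabs (s' * L s' - s * L s) <= (m2 + kappa) * Rabs (s' - s)).
    { rewrite He, Rabs_mult. apply Rmult_le_compat_r; [apply Rabs_pos|exact Hb]. }
    generalize (Rle_abs (s' * L s' - s * L s)); lra.
- intros [Hlt|<-]; [|lra].
  destruct (MVT_cor2 (fun s => s * L s) (fun s => L s + s * dL s) s s' Hlt) as [c [He Hc]].
  { intros c Hc. apply is_derive_Reals, DP; lra. }
  assert (Hc' := A1 s c Hs ltac:(lra)).
  rewrite (Rabs_pos_eq (c - s)) in Hc' by lra. apply Rabs_le_between in Hc'.
  assert (Hd := Hsd c ltac:(lra)).
  assert (Hk2 : kappa * (c - s) <= kappa * (s' - s)) by (apply Rmult_le_compat_l; lra).
  assert ((L s - kappa * (s' - s) - kappa) * (s' - s) <= (L c + c * dL c) * (s' - s))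
    by (apply Rmult_le_compat_r; lra).
  lra.
Qed.

(** * Lower bounds in the strip *)

Lemma exp_le (x y : R) : x <= y -> exp x <= exp y.
Proof. intros [H|<-]; [left; apply exp_increasing, H|lra]. Qed.

Lemma Rdiv_le_compat_r_pos (c x y : R) : 0 < c -> 0 < x -> x <= y -> c / y <= c / x.
Proof.
intros Hc Hx Hxy. apply Rmult_le_compat_l; [lra|]. apply Rinv_le_contravar; easy.
Qed.

Lemma harmonic_at_continuity (h : R -> R -> R) (phi dphi : C -> C) (s t : R) :
  harmonic_at h phi dphi s t -> continuity_pt (fun s => h s t) s.
Proof.
intros [H _]. apply derivable_continuous_pt. eexists. apply is_derive_Reals.
apply (is_derive_slice1 _ _ _ _ _ H).
Qed.

Lemma induction_on_windows (Q : R -> Prop) (S T : R) :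
  0 < T -> (forall s, S <= s <= S + T -> Q s) ->
  (forall s, S <= s -> Q s -> Q (s + T)) -> forall s, S <= s -> Q s.
Proof.
intros HT Hbase Hstep.
assert (Hn : forall n s, S <= s <= S + (INR n + 1) * T -> Q s).
{ induction n as [|n IH]; intros s Hs.
  - apply Hbase. simpl in Hs. lra.
  - destruct (Rle_dec s (S + (INR n + 1) * T)) as [H1|H1]; [apply IH; lra|].
    rewrite S_INR in Hs.
    destruct (Rle_dec s (S + T)) as [H2|H2]; [apply Hbase; lra|].
    replace s with (s - T + T) by ring.
    apply Hstep; [lra|]. apply IH. lra. }
intros s Hs. destruct (INR_archimed T (s - S) HT) as [n Hn2].
apply (Hn n). lra.
Qed.

(** The choice of constants is circular unless made in this order.  Two exponents
    q < q2 < q1 < q3 come first: a strip of width PI / (L(s0) q1) fits, with a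
    margin d for the discs, inside the domain as long as L(s) q <= L(s0) q2.  They
    fix the constant C0 lost per window, then the length T for which
    2 C0 <= exp (m1 (q3 - q1) T / 2), then the tolerance kappa on the variation
    of L, and last the starting point S. *)
Lemma axis_lower_bound (h : R -> R -> R) (phi dphi : C -> C) (L : R -> R)
  (m1 m2 p q q3 sigma : R) :
  0 < m1 -> slowly_varying L m1 m2 -> 0 < q -> q < q3 -> 0 < p -> p < q3 -> q3 < 1 ->
  (forall s t, sigma < s -> Rabs t <= PI / (2 * L s * q) ->
     harmonic_at h phi dphi s t /\ h s t <= exp (p * (s * L s))) ->
  exists S C, 0 < C /\ forall s, S <= s -> - h s 0 <= C * exp (q3 * (s * L s)).
Proof.
intros Hm1 HL Hq Hqq3 Hp Hpq3 Hq3 H. assert (Hpi := PI_RGT_0).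
assert (Hm12 : m1 <= m2).
{ destruct (HL 1 Rlt_0_1) as [S [dL [_ HS]]]. destruct (HS S (Rle_refl _)) as [_ [? _]]. lra. }
set (q1 := (q + q3) / 2). set (q2 := (q + q1) / 2).
assert (Hq1 : q < q1 < q3) by (unfold q1; lra).
assert (Hq2 : q < q2 < q1) by (unfold q2; lra).
set (w0 := PI / (2 * m1 * q1)).
set (w1 := PI / (2 * m2 * q1)).
assert (Hm1q : 0 < m1 * q1) by (apply Rmult_lt_0_compat; lra).
assert (Hm2q : 0 < m2 * q1) by (apply Rmult_lt_0_compat; lra).
assert (Hw0 : 0 < w0) by (apply Rdiv_lt_0_compat; lra).
assert (Hw1 : 0 < w1) by (apply Rdiv_lt_0_compat; lra).
(* w0 and w1 bound the half-widths PI / (2 L(s0) q1) from above and below, and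
   (q1 - q2) / q2 is the relative margin q1 / q2 - 1. *)
set (d := Rmin 1 (w1 * ((q1 - q2) / q2))).
assert (Hqf : 0 < (q1 - q2) / q2) by (apply Rdiv_lt_0_compat; lra).
assert (Hd : 0 < d <= 1).
{ split; [apply Rmin_pos; [lra|apply Rmult_lt_0_compat; easy]|apply Rmin_l]. }
assert (Hd2 : d <= w1 * ((q1 - q2) / q2)) by apply Rmin_r.
set (C0 := exp (8 * w0 / d) ^ 2 / (1 - exp (- (2 * (m1 * q1))))).
assert (Hden : 0 < 1 - exp (- (2 * (m1 * q1)))).
{ apply Rlt_0_minus. rewrite <- exp_0. apply exp_increasing. lra. }
assert (HC0 : 1 <= C0).
{ unfold C0. apply Rmult_le_reg_r with (1 - exp (- (2 * (m1 * q1)))); [easy|].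
  unfold Rdiv. rewrite Rmult_assoc, Rinv_l, Rmult_1_r, Rmult_1_l by lra.
  assert (0 < 8 * w0 / d) by (apply Rdiv_lt_0_compat; lra).
  assert (1 <= exp (8 * w0 / d)) by (rewrite <- exp_0; apply exp_le; lra).
  generalize (exp_pos (- (2 * (m1 * q1)))); nra. }
assert (Hln : 0 < ln (2 * C0)) by (rewrite <- ln_1; apply ln_increasing; lra).
assert (Hmq : 0 < m1 * (q3 - q1)) by (apply Rmult_lt_0_compat; lra).
set (T := 2 * ln (2 * C0) / (m1 * (q3 - q1))).
assert (HT : 0 < T) by (apply Rdiv_lt_0_compat; lra).
assert (HTe : T * (m1 * (q3 - q1)) = 2 * ln (2 * C0)) by (unfold T; field; lra).
assert (Hq2q : 0 < m1 * (q2 / q - 1)).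
{ apply Rmult_lt_0_compat; [easy|].
  replace (q2 / q - 1) with ((q2 - q) / q) by (field; lra).
  apply Rdiv_lt_0_compat; lra. }
set (kappa := Rmin (m1 * (q2 / q - 1) / (T + 2)) (m1 * (q3 - q1) / 2 / (T + 1))).
assert (Hk : 0 < kappa).
{ apply Rmin_pos; apply Rdiv_lt_0_compat; lra. }
assert (Hk1 : kappa * (T + 2) <= m1 * (q2 / q - 1)).
{ apply Rle_trans with (m1 * (q2 / q - 1) / (T + 2) * (T + 2)).
  - apply Rmult_le_compat_r; [lra|apply Rmin_l].
  - apply Req_le. field. lra. }
assert (Hk2 : kappa * (T + 1) <= m1 * (q3 - q1) / 2).
{ apply Rle_trans with (m1 * (q3 - q1) / 2 / (T + 1) * (T + 1)).
  - apply Rmult_le_compat_r; [lra|apply Rmin_r].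
  - apply Req_le. field. lra. }
destruct (HL kappa Hk) as [S1 [dL [HS1 HS]]].
assert (Hslow := slow_variation L dL m1 m2 kappa S1 HS1 (Rlt_le _ _ Hm1) HS).
set (B := (m2 + kappa) * (T + 2)).
assert (HB : 0 < B) by (apply Rmult_lt_0_compat; lra).
assert (Hpm : 0 < (q3 - p) * m1) by (apply Rmult_lt_0_compat; lra).
(* From A on, the bound M for h on a window is below exp (q3 s L(s)). *)
set (A := p * B / ((q3 - p) * m1)).
assert (HA : 0 < A) by (apply Rdiv_lt_0_compat; [apply Rmult_lt_0_compat; easy|easy]).
set (S := S1 + Rabs sigma + 2 + A).
assert (HSs : S1 <= S - 2 /\ sigma <= S - 2 /\ A <= S).
{ unfold S. generalize (Rle_abs sigma) (Rabs_pos sigma); lra. }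
assert (HLpos : forall s, S1 <= s -> m1 <= L s <= m2) by (intros s Hs; apply HS, Hs).
assert (HPpos : forall s, S1 <= s -> s * m1 <= s * L s).
{ intros s Hs. apply Rmult_le_compat_l; [lra|]. apply HLpos, Hs. }
(* The first window is handled by compactness. *)
assert (Hbase : exists C, 1 <= C /\ forall s, S <= s <= S + T -> - h s 0 <= C).
{ destruct (continuity_ab_maj (fun s => - h s 0) S (S + T)) as [x [Hx _]].
  - lra.
  - intros c Hc. apply continuity_pt_opp.
    apply (harmonic_at_continuity h phi dphi). apply H; [lra|].
    rewrite Rabs_R0. destruct (HLpos c ltac:(lra)) as [Hc1 _].
    left. apply Rdiv_lt_0_compat; [easy|]. apply Rmult_lt_0_compat; lra.
  - exists (Rmax 1 (- h x 0)). split; [apply Rmax_l|].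
    intros s Hs. eapply Rle_trans; [apply (Hx s Hs)|apply Rmax_r]. }
destruct Hbase as [C [HC1 Hbase]].
exists S, C. split; [lra|].
apply (induction_on_windows _ S T HT).
- intros s Hs. eapply Rle_trans; [apply Hbase, Hs|].
  rewrite <- (Rmult_1_r C) at 1. apply Rmult_le_compat_l; [lra|].
  rewrite <- exp_0. apply exp_le.
  assert (G := HPpos s ltac:(lra)).
  assert (0 <= s * m1) by (apply Rmult_le_pos; lra).
  apply Rmult_le_pos; lra.
- intros s0 Hs0 Hind.
  destruct (HLpos s0 ltac:(lra)) as [HL1 HL2].
  set (a := L s0 * q1). set (w := PI / (2 * a)).
  assert (Ha : m1 * q1 <= a) by (apply Rmult_le_compat_r; lra).
  assert (Ha2 : a <= m2 * q1) by (apply Rmult_le_compat_r; lra).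
  assert (Hww0 : w <= w0) by (apply Rdiv_le_compat_r_pos; lra).
  assert (Hww1 : w1 <= w) by (apply Rdiv_le_compat_r_pos; lra).
  set (M := exp (p * (s0 * L s0 + B))).
  assert (Hwin : forall s t, s0 - 2 < s < s0 + T + 2 -> Rabs t < w + d ->
     harmonic_at h phi dphi s t /\ h s t <= M).
  { intros s t Hs Ht.
    destruct (Hslow s0 s ltac:(lra) ltac:(lra)) as [V1 [V2 _]].
    assert (Hab : Rabs (s - s0) <= T + 2) by (apply Rabs_le; lra).
    assert (Hkab : kappa * Rabs (s - s0) <= kappa * (T + 2))
      by (apply Rmult_le_compat_l; lra).
    destruct (HLpos s ltac:(lra)) as [HLs _].
    destruct (H s t) as [Hg Hh]; [lra| |split; [exact Hg|]].
    - assert (HLq : L s * q <= L s0 * q2).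
      { apply Rle_trans with ((L s0 + m1 * (q2 / q - 1)) * q).
        - apply Rmult_le_compat_r; lra.
        - apply Rle_trans with ((L s0 + L s0 * (q2 / q - 1)) * q).
          + apply Rmult_le_compat_r; [lra|]. apply Rplus_le_compat_l.
            apply Rmult_le_compat_r; [|lra].
            apply Rmult_le_reg_l with m1; lra.
          + apply Req_le. field. lra. }
      assert (Hwide : w + d <= PI / (2 * L s * q)).
      { apply Rle_trans with (PI / (2 * (L s0 * q2))).
        - replace (PI / (2 * (L s0 * q2))) with (w + w * ((q1 - q2) / q2))
            by (unfold w, a; field; lra).
          apply Rplus_le_compat_l. eapply Rle_trans; [exact Hd2|].
          apply Rmult_le_compat_r; lra.
        - apply Rdiv_le_compat_r_pos; [easy| |lra].
          rewrite Rmult_assoc. apply Rmult_lt_0_compat; [lra|].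
          apply Rmult_lt_0_compat; lra. }
      lra.
    - eapply Rle_trans; [exact Hh|]. apply exp_le.
      apply Rmult_le_compat_l; [lra|].
      assert ((m2 + kappa) * Rabs (s - s0) <= B)
        by (apply Rmult_le_compat_l; lra).
      lra. }
  assert (Haw : a * w = PI / 2) by (unfold w; field; lra).
  assert (G := window_growth h phi dphi M a w d s0 T ltac:(lra) Haw Hd (Rlt_le _ _ HT) Hwin).
  set (K := exp (q3 * (s0 * L s0))) in *.
  assert (HP0 := HPpos s0 ltac:(lra)).
  assert (HMK : M <= K).
  { apply exp_le.
    assert (HAe : A * ((q3 - p) * m1) = p * B) by (unfold A; field; lra).
    assert (A * ((q3 - p) * m1) <= s0 * ((q3 - p) * m1)) by (apply Rmult_le_compat_r; lra).
    assert ((q3 - p) * (s0 * m1) <= (q3 - p) * (s0 * L s0)) by (apply Rmult_le_compat_l; lra).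
    lra. }
  assert (HK : 0 < K) by apply exp_pos.
  assert (HM : 0 < M) by apply exp_pos.
  assert (Hu : M - h s0 0 <= 2 * (C * K)).
  { assert (K <= C * K) by (rewrite <- (Rmult_1_l K) at 1; apply Rmult_le_compat_r; lra). lra. }
  assert (Hu0 : 0 <= M - h s0 0).
  { assert (0 < w) by lra.
    destruct (Hwin s0 0) as [_ Hh]; [lra|rewrite Rabs_R0; lra|lra]. }
  assert (HCw : exp (8 * w / d) ^ 2 / (1 - exp (- (2 * a))) <= C0).
  { unfold C0. apply Rmult_le_compat.
    - apply pow2_ge_0.
    - left. apply Rinv_0_lt_compat, Rlt_0_minus. rewrite <- exp_0. apply exp_increasing. lra.
    - apply pow_incr. split; [left; apply exp_pos|]. apply exp_le.
      apply Rmult_le_compat_r; [left; apply Rinv_0_lt_compat; lra|lra].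
    - apply Rinv_le_contravar; [easy|].
      assert (exp (- (2 * a)) <= exp (- (2 * (m1 * q1)))) by (apply exp_le; lra). lra. }
  assert (G2 : - h (s0 + T) 0 <= C0 * exp (a * T) * (2 * (C * K))).
  { apply Rle_trans with (M - h (s0 + T) 0); [lra|].
    eapply Rle_trans; [exact G|]. apply Rmult_le_compat; [|easy| |easy].
    - apply Rmult_le_pos; [|left; apply exp_pos].
      apply Rmult_le_pos; [apply pow2_ge_0|].
      left. apply Rinv_0_lt_compat, Rlt_0_minus. rewrite <- exp_0. apply exp_increasing. lra.
    - apply Rmult_le_compat_r; [left; apply exp_pos|easy]. }
  eapply Rle_trans; [exact G2|].
  replace (C0 * exp (a * T) * (2 * (C * K))) with
    (C * ((2 * C0) * exp (a * T) * K)) by ring.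
  apply Rmult_le_compat_l; [lra|].
  rewrite <- (exp_ln (2 * C0)) by lra. unfold K. rewrite <- !exp_plus.
  apply exp_le.
  destruct (Hslow s0 (s0 + T) ltac:(lra) ltac:(lra)) as [_ [_ V3]].
  specialize (V3 ltac:(lra)). replace (s0 + T - s0) with T in V3 by ring.
  assert (V4 : q3 * (s0 * L s0 + (L s0 - kappa * T - kappa) * T) <=
    q3 * ((s0 + T) * L (s0 + T))) by (apply Rmult_le_compat_l; lra).
  eapply Rle_trans; [|exact V4]. unfold a.
  assert (V5 : T * (m1 * (q3 - q1)) <= T * (L s0 * (q3 - q1))).
  { apply Rmult_le_compat_l; [lra|]. apply Rmult_le_compat_r; lra. }
  assert (V6 : q3 * (T * (kappa * (T + 1))) <= 1 * (T * (m1 * (q3 - q1) / 2))).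
  { apply Rmult_le_compat; [lra| |lra|].
    - apply Rmult_le_pos; [lra|apply Rmult_le_pos; lra].
    - apply Rmult_le_compat_l; lra. }
  apply Rminus_le. lra.
Qed.

(** Half of delta pays for the change of the width of the domain over a disc of
    radius d <= delta / 2, the other half for the disc itself. *)
Lemma sector_lower_bound (h : R -> R -> R) (phi dphi : C -> C) (L : R -> R)
  (m1 m2 p q delta sigma : R) :
  0 < m1 -> slowly_varying L m1 m2 -> 0 < q -> q < 1 -> 0 < p -> p < 1 -> 0 < delta ->
  (forall s t, sigma < s -> Rabs t <= PI / (2 * L s * q) ->
     harmonic_at h phi dphi s t /\ h s t <= exp (p * (s * L s))) ->
  exists S, forall s t, S <= s -> Rabs t <= PI / (2 * L s * q) - delta ->
    - exp (s * L s) < h s t.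
Proof.
intros Hm1 HL Hq Hq1 Hp Hp1 Hdelta H. assert (Hpi := PI_RGT_0).
set (q3 := (1 + Rmax p q) / 2).
assert (Hq3 : p < q3 /\ q < q3 /\ q3 < 1).
{ assert (Rmax p q < 1) by (apply Rmax_lub_lt; lra).
  unfold q3. generalize (Rmax_l p q) (Rmax_r p q); lra. }
destruct (axis_lower_bound h phi dphi L m1 m2 p q q3 sigma) as [S0 [C [HC Hax]]]; try easy.
set (d := Rmin 1 (delta / 2)).
assert (Hd : 0 < d) by (apply Rmin_pos; lra).
assert (Hd1 : d <= 1) by apply Rmin_l.
assert (Hd2 : d <= delta / 2) by apply Rmin_r.
(* With this kappa the half-width changes by at most delta / 2 over a unit
   length. *)
set (kappa := delta * q * m1 ^ 2 / PI).
assert (Hm12 : 0 < m1 ^ 2) by (apply pow_lt; easy).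
assert (Hk : 0 < kappa).
{ apply Rdiv_lt_0_compat; [|easy]. apply Rmult_lt_0_compat; [apply Rmult_lt_0_compat|]; easy. }
destruct (HL kappa Hk) as [S1 [dL [HS1 HS]]].
assert (Hslow := slow_variation L dL m1 m2 kappa S1 HS1 (Rlt_le _ _ Hm1) HS).
assert (Hm2 : m1 <= m2) by (destruct (HS S1 (Rle_refl _)) as [_ [? _]]; lra).
set (w0 := PI / (2 * m1 * q)).
set (E := exp (8 * w0 / d)).
set (K := exp (p * (m2 + kappa)) + C).
assert (HE : 0 < E) by apply exp_pos.
assert (HK : 0 < K) by (unfold K; generalize (exp_pos (p * (m2 + kappa))); lra).
assert (HEK : 0 < E * K) by (apply Rmult_lt_0_compat; easy).
assert (Hqm : 0 < (1 - q3) * m1) by (apply Rmult_lt_0_compat; lra).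
set (A := Rabs (ln (E * K)) / ((1 - q3) * m1) + 1).
assert (HA : 0 <= A).
{ unfold A. assert (0 <= Rabs (ln (E * K)) / ((1 - q3) * m1)); [|lra].
  apply Rmult_le_pos; [apply Rabs_pos|left; apply Rinv_0_lt_compat; easy]. }
set (S := S1 + Rabs sigma + Rabs S0 + 1 + A).
assert (HSs : S1 <= S - 1 /\ sigma <= S - 1 /\ S0 <= S /\ A <= S).
{ unfold S. generalize (Rle_abs sigma) (Rabs_pos sigma) (Rle_abs S0) (Rabs_pos S0); lra. }
exists S. intros s t Hs Ht.
assert (HLpos : forall x, S1 <= x -> m1 <= L x <= m2) by (intros x Hx; apply HS, Hx).
destruct (HLpos s ltac:(lra)) as [HL1 HL2].
set (w := PI / (2 * L s * q) - delta) in *.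
assert (Hw : 0 <= w) by (eapply Rle_trans; [apply Rabs_pos|exact Ht]).
assert (Hww0 : w <= w0).
{ assert (PI / (2 * L s * q) <= w0); [|unfold w; lra].
  apply Rdiv_le_compat_r_pos; [easy| |].
  - apply Rmult_lt_0_compat; lra.
  - apply Rmult_le_compat_r; lra. }
set (P := s * L s).
assert (HP : s * m1 <= P) by (apply Rmult_le_compat_l; lra).
assert (HP0 : 0 <= P) by (assert (0 <= s * m1) by (apply Rmult_le_pos; lra); lra).
set (M := exp (p * (P + (m2 + kappa)))).
assert (Hbox : forall x y, Rabs (x - s) < d -> Rabs y < w + d ->
     harmonic_at h phi dphi x y /\ h x y <= M).
{ intros x y Hx Hy.
  assert (Hx' := Rabs_def2 _ _ Hx).
  destruct (Hslow s x ltac:(lra) ltac:(lra)) as [V1 [V2 _]].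
  destruct (HLpos x ltac:(lra)) as [HLx _].
  destruct (H x y) as [Hg Hh]; [lra| |split; [exact Hg|]].
  - assert (Hk1 : kappa * Rabs (x - s) <= kappa * 1) by (apply Rmult_le_compat_l; lra).
    assert (Hdiff : PI / (2 * L s * q) - PI / (2 * L x * q) <= delta / 2).
    { replace (PI / (2 * L s * q) - PI / (2 * L x * q)) with
        (PI / (2 * q) * (L x - L s) * / (L s * L x)) by (field; lra).
      assert (Hpq : 0 < PI / (2 * q)) by (apply Rdiv_lt_0_compat; lra).
      apply Rle_trans with (PI / (2 * q) * kappa * / (m1 ^ 2)).
      2:{ apply Req_le. unfold kappa. field. lra. }
      apply Rle_trans with (PI / (2 * q) * kappa * / (L s * L x)).
      - apply Rmult_le_compat_r.
        + left. apply Rinv_0_lt_compat, Rmult_lt_0_compat; lra.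
        + apply Rmult_le_compat_l; lra.
      - apply Rmult_le_compat_l.
        + apply Rmult_le_pos; lra.
        + apply Rinv_le_contravar; [easy|]. simpl. rewrite Rmult_1_r.
          apply Rmult_le_compat; lra. }
    unfold w in Hy. lra.
  - eapply Rle_trans; [exact Hh|]. apply exp_le.
    apply Rmult_le_compat_l; [lra|].
    assert ((m2 + kappa) * Rabs (x - s) <= (m2 + kappa) * 1)
      by (apply Rmult_le_compat_l; lra).
    unfold P. lra. }
assert (R0 : Rabs 0 <= w) by (rewrite Rabs_R0; easy).
assert (G := harnack_vertical h phi dphi M s w d Hd Hbox 0 t R0 Ht).
set (F := exp (q3 * P)).
assert (HF : 0 < F) by apply exp_pos.
assert (HM : 0 < M) by apply exp_pos.
assert (HMF : M <= exp (p * (m2 + kappa)) * F).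
{ unfold M, F. rewrite <- exp_plus. apply exp_le.
  assert (p * P <= q3 * P) by (apply Rmult_le_compat_r; lra). lra. }
assert (Hu : M - h s 0 <= K * F).
{ generalize (Hax s ltac:(lra)). fold P. fold F. unfold K. lra. }
assert (Hu0 : 0 <= M - h s 0).
{ destruct (Hbox s 0) as [_ Hh]; [rewrite Rminus_diag, Rabs_R0; lra|lra|lra]. }
assert (G2 : M - h s t <= E * (K * F)).
{ eapply Rle_trans; [exact G|]. apply Rmult_le_compat; [left; apply exp_pos|easy| |easy].
  apply exp_le. apply Rmult_le_compat_r; [left; apply Rinv_0_lt_compat; lra|lra]. }
assert (G3 : E * (K * F) < exp P).
{ rewrite <- Rmult_assoc, <- (exp_ln (E * K)) by easy. unfold F. rewrite <- exp_plus.
  apply exp_increasing.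
  assert (HAe : A * ((1 - q3) * m1) = Rabs (ln (E * K)) + (1 - q3) * m1)
    by (unfold A; field; lra).
  assert (A * ((1 - q3) * m1) <= s * ((1 - q3) * m1)) by (apply Rmult_le_compat_r; lra).
  assert ((1 - q3) * (s * m1) <= (1 - q3) * P) by (apply Rmult_le_compat_l; lra).
  generalize (Rle_abs (ln (E * K))). lra. }
lra.
Qed.

Theorem proposition4 :
  forall (l : R -> R) (l1 l2 eps q rho : R) (G : C -> C),
    generalized_proximate_order 1 l ->
    LimInf_infty l = Finite l1 ->
    LimSup_infty l = Finite l2 ->
    0 < l1 -> l1 < l2 ->
    0 < eps ->
    0 < q -> q < 1 ->
    1 <= rho ->
    analytic_on (curved_sector l q rho) G ->
    (forall z : C, curved_sector l q rho z -> G z <> RtoC 0) ->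
    (forall r theta : R,
       rho < r -> Rabs theta <= PI / (2 * l r * q) ->
       ln (Cmod (G (polar r theta))) < Rpower r (l r / (1 + eps))) ->
    forall delta : R,
      0 < delta -> delta < PI / (2 * l2 * q) ->
      exists r1 : R, forall r theta : R,
        r1 <= r -> Rabs theta <= PI / (2 * l r * q) - delta ->
        ln (Cmod (G (polar r theta))) > - Rpower r (l r).
Proof.
intros l l1 l2 eps q rho G Hl Hinf Hsup Hl1 Hl12 Heps Hq Hq1 Hrho HG HG0 HGb delta Hdelta _.
assert (HL := proximate_order_slowly_varying l l1 l2 Hl Hinf Hsup Hl1).
destruct (log_modulus_harmonic _ G HG HG0) as [phi [dphi Hphi]].
set (p := / (1 + eps)).
assert (Hp : 0 < p < 1).
{ split; [apply Rinv_0_lt_compat; lra|]. rewrite <- Rinv_1. apply Rinv_lt_contravar; lra. }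
destruct (sector_lower_bound (fun s t => ln (Cmod (G (polar (exp s) t)))) phi dphi
  (fun s => l (exp s)) (l1 / 2) (l2 + 1) p q delta (ln rho)) as [S HS]; try lra.
- exact HL.
- intros s t Hs Ht.
  assert (Hr : rho < exp s) by (rewrite <- (exp_ln rho) by lra; apply exp_increasing, Hs).
  split.
  + apply Hphi. exists (exp s), t. easy.
  + left. eapply Rlt_le_trans; [apply HGb; easy|].
    unfold Rpower. rewrite ln_exp. apply Req_le. f_equal. unfold p. field. lra.
- exists (exp S). intros r theta Hr Ht.
  assert (Hr0 : 0 < r) by (eapply Rlt_le_trans; [apply exp_pos|exact Hr]).
  assert (Hs : S <= ln r).
  { rewrite <- (ln_exp S). destruct Hr as [Hr| ->]; [left; apply ln_increasing; [apply exp_pos|easy]|lra]. }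
  generalize (HS (ln r) theta Hs). rewrite exp_ln by easy.
  intros H. specialize (H Ht). unfold Rpower. rewrite (Rmult_comm (l r)). lra.
Qed.
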